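(* Let $1\le d\le 3$ and $m\ge 1$ be integers, and let $\Omega=[-\pi,\pi]^d$ be the $2\pi$-periodic $d$-dimensional torus. Consider the vector-valued Allen-Cahn equation for $\mathbf u:[0,\infty)\times\Omega\to\mathbb R^m$, $$\partial_t\mathbf u=\Delta\mathbf u+(1-|\mathbf u|^2)\mathbf u,\quad (t,x)\in(0,\infty)\times\Omega;\qquad \mathbf u|_{t=0}=\mathbf u^0,$$ where $\mathbf u^0\in L^2(\Omega,\mathbb R^m)$ is the initial data. Let $\tau>0$. Set $\mathcal S_{\mathcal L}(t)=e^{t\Delta}$ (applied component-wise), and for $\mathbf w\in\mathbb R^m$ set $$\mathcal S_{\mathcal N}(t)\mathbf w=\big((e^{2t}-1)|\mathbf w|^2+1\big)^{-\frac12}e^t\,\mathbf w,$$ applied pointwise in $x$ to functions $\Omega\to\mathbb R^m$. Define the Strang-splitting iterates, for $n\ge 0$, by $$\mathbf u^{n+1}=\mathcal S_{\mathcal L}(\tau/2)\,\mathcal S_{\mathcal N}(\tau)\,\mathcal S_{\mathcal L}(\tau/2)\,\mathbf u^n.$$ Then the following hold. (1) (Maximum principle) For any $\tau>0$ and any $n\ge 0$, $$\big\|\,|\mathbf u^{n+1}|\,\big\|_{L^\infty_x}\le\max\{1,\ \big\|\,|\mathbf u^n|\,\big\|_{L^\infty_x}\}.$$ Consequently $\sup_{n\ge1}\|\,|\mathbf u^n|\,\|_{L^\infty_x}\le\max\{1,\ \|\,|\mathbf u^0|\,\|_{L^\infty_x}\}$. In particular, if $\|\,|\mathbf u^0|\,\|_{L^\infty_x}\le1$,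 then $\sup_{n\ge1}\|\,|\mathbf u^n|\,\|_{L^\infty_x}\le1$. (2) (Modified energy dissipation) For any $\tau>0$, $$\widetilde E(\tilde{\mathbf u}^{n+1})\le\widetilde E(\tilde{\mathbf u}^n)\quad\text{for all } n\ge0,$$ where $\tilde{\mathbf u}^n=\mathcal S_{\mathcal L}(\tau/2)\mathbf u^n$, $$\widetilde E(\mathbf u)=\int_\Omega\Big(\frac1{2\tau}\big\langle(e^{-\tau\Delta}-1)\mathbf u,\mathbf u\big\rangle+G(\mathbf u)\Big)\,dx,$$ $$G(\mathbf u)=\frac1{2\tau}|\mathbf u|^2-\frac{e^\tau}{\tau(e^{2\tau}-1)}\Big(\big(1+(e^{2\tau}-1)|\mathbf u|^2\big)^{\frac12}-1\Big).$$
   Context: For $\mathbf a=(a_1,\dots,a_m)^{\mathrm T},\mathbf b=(b_1,\dots,b_m)^{\mathrm T}\in\mathbb R^m$, $\langle\mathbf a,\mathbf b\rangle=\sum_{i=1}^m a_ib_i$ and $|\mathbf a|^2=\langle\mathbf a,\mathbf a\rangle$. The Laplacian is applied component-wise with periodic boundary conditions. For $t>0$, $e^{t\Delta}$ is the heat semigroup on the torus, i.e. the Fourier multiplier $e^{-t|k|^2}$, $k\in\mathbb Z^d$; equivalently, convolution with the scalar periodic heat kernel. $e^{-\tau\Delta}$ is the Fourier multiplier $e^{\tau|k|^2}$, and the term $\int_\Omega\langle(e^{-\tau\Delta}-1)\mathbf u,\mathbf u\rangle\,dx$ is understood as the corresponding quadratic form $(2\pi)^d\sum_{k\in\mathbb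 Z^d}(e^{\tau|k|^2}-1)|\hat{\mathbf u}(k)|^2$, where $\hat{\mathbf u}(k)=(2\pi)^{-d}\int_\Omega\mathbf u(x)e^{-ik\cdot x}dx$; it is finite for $\mathbf u=\mathcal S_{\mathcal L}(\tau/2)\mathbf v$ with $\mathbf v\in L^2$. $\|\,|\mathbf v|\,\|_{L^\infty_x}$ is the essential supremum over $x\in\Omega$ of $|\mathbf v(x)|$, with values in $[0,\infty]$. *)

(* Defs.v *)
From HB Require Import structures.
From mathcomp Require Import all_boot all_order all_algebra.
From mathcomp Require Import all_classical all_reals all_analysis.
From mathcomp Require Import ess_sup_inf.
From mathcomp Require Import complex.
From mathcomp.analysis Require showcase.summability.

Set Implicit Arguments.
Unset Strict Implicit.
Unset Printing Implicit Defensive.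

Import Order.TTheory GRing.Theory Num.Theory.
Import numFieldNormedType.Exports.

Local Open Scope classical_set_scope.
Local Open Scope ring_scope.

Definition inner (R : realType) (m : nat) (a b : 'cV[R]_m) : R :=
  \sum_(i < m) a i ord0 * b i ord0.

(* The library norm on matrices is the max norm, hence this Euclidean one. *)
Definition enorm (R : realType) (m : nat) (a : 'cV[R]_m) : R :=
  Num.sqrt (inner a a).

(* R^d with the product Borel sigma-algebra. *)
Notation Rspace R d := (d.-tuple (measurableTypeR R)).

Section torus_measure.
Variable R : realType.

Let itv_finite :
  (lebesgue_measure ([set` `[- (pi : R), pi]%R] : set R) < +oo)%E.
Proof. by rewrite lebesgue_measure_itv /=; case: ifP => _; rewrite ltry. Qed.

(* Lebesgue measure restricted to [-pi, pi], as a measure on R. *)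
Definition circle_measure : {finite_measure set (measurableTypeR R) -> \bar R} :=
  @mfrestr _ (measurableTypeR R) R _ lebesgue_measure
    (measurable_itv `[- (pi : R), pi]%R) itv_finite.

Section step.
Variables (n : nat) (mu : {finite_measure set (Rspace R n) -> \bar R}).

Definition tcons (p : measurableTypeR R * Rspace R n) : Rspace R n.+1 :=
  [tuple of p.1 :: p.2].

Lemma measurable_tcons : measurable_fun [set: _] tcons.
Proof. exact: measurable_cons. Qed.

Definition torus_measureS : set (Rspace R n.+1) -> \bar R :=
  pushforward (circle_measure \x mu)%E tcons.

Let torus_measureS0 : torus_measureS set0 = 0%E.
Proof. by rewrite /torus_measureS /pushforward preimage_set0 measure0. Qed.

Let torus_measureS_ge0 A : (0 <= torus_measureS A)%E.
Proof. by rewrite /torus_measureS /pushforward measure_ge0. Qed.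

Let torus_measureS_sigma_additive : semi_sigma_additive torus_measureS.
Proof.
move=> F mF tF mUF; rewrite /torus_measureS /pushforward preimage_bigcup.
apply: measure_semi_sigma_additive.
- by move=> n'; rewrite -[X in measurable X]setTI; exact: measurable_tcons.
- apply/trivIsetP => /= i j _ _ ij; rewrite -preimage_setI.
  by move/trivIsetP : tF => /(_ _ _ _ _ ij) ->//; rewrite preimage_set0.
- by rewrite -preimage_bigcup -[X in measurable X]setTI; exact: measurable_tcons.
Qed.

HB.instance Definition _ := isMeasure.Build _ _ _ torus_measureS
  torus_measureS0 torus_measureS_ge0 torus_measureS_sigma_additive.

Let torus_measureS_finite : fin_num_fun torus_measureS.
Proof.
apply: lty_fin_num_fun; rewrite /= /torus_measureS /pushforward preimage_setT.
rewrite -setXTT product_measure1E//.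
by rewrite lte_mul_pinfty// ?fin_num_measure// ltey_eq fin_num_measure.
Qed.

HB.instance Definition _ := Measure_isFinite.Build _ _ _ torus_measureS
  torus_measureS_finite.

End step.

(* Lebesgue measure on the box Omega = [-pi, pi]^d, as a measure on R^d that
   vanishes outside Omega. Integrating a function against it is integrating over
   Omega, and the values of the function outside Omega are irrelevant. *)
Fixpoint torus_measure (d : nat) : {finite_measure set (Rspace R d) -> \bar R} :=
  match d with
  | 0 => dirac ([tuple] : Rspace R 0)
  | n.+1 => torus_measureS (torus_measure n)
  end.

End torus_measure.

Section fields.
Variables (R : realType) (d m : nat).
Implicit Types (u v : Rspace R d -> 'cV[R]_m) (k : d.-tuple int).

Definition L2 u : Prop :=
  forall j, (fun x => u x j ord0) \in Lfun (torus_measure R d) 2%:E.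

Definition Linfty_norm v : \bar R :=
  ess_sup (torus_measure R d) (fun x => (enorm (v x))%:E).

Definition freq2 k : R := \sum_(i < d) (tnth k i)%:~R ^+ 2.

Definition phase k (x : Rspace R d) : R :=
  \sum_(i < d) (tnth k i)%:~R * (tnth x i : R).

Definition expi (t : R) : R[i] := Complex (cos t) (sin t).

Definition cintegral (f : Rspace R d -> R[i]) : R[i] :=
  Complex (\int[torus_measure R d]_x complex.Re (f x))
          (\int[torus_measure R d]_x complex.Im (f x)).

(* The j-th component of the Fourier coefficient of u at k. *)
Definition fourier u k (j : 'I_m) : R[i] :=
  (real_complex R ((2 * pi) ^- d)) *
  cintegral (fun x => real_complex R (u x j ord0) * expi (- phase k x)).

Definition fourier_norm2 u k : R :=
  \sum_(j < m) (complex.Re (fourier u k j) ^+ 2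
              + complex.Im (fourier u k j) ^+ 2).

(* The Fourier multiplier exp (- t |k|^2), for t > 0. The series is absolutely
   convergent for u in L^2; it is summed in the sense of unconditional
   convergence. As u is real-valued, the terms of k and -k are conjugate, so the
   full complex sum is the sum of the real parts. *)
Definition heat (t : R) u : Rspace R d -> 'cV[R]_m := fun x =>
  \col_j (summability.sum (fun k : d.-tuple int =>
     expR (- t * freq2 k) * complex.Re (fourier u k j * expi (phase k x))
     : R^o)).

Definition reaction (t : R) (w : 'cV[R]_m) : 'cV[R]_m :=
  ((((expR (2 * t) - 1) * enorm w ^+ 2 + 1) `^ (- 2^-1)) * expR t) *: w.

Definition strang_step (tau : R) u : Rspace R d -> 'cV[R]_m :=
  heat (tau / 2) (fun x => reaction tau (heat (tau / 2) u x)).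

Definition strang (tau : R) (u0 : Rspace R d -> 'cV[R]_m) (n : nat) :
    Rspace R d -> 'cV[R]_m :=
  iter n (strang_step tau) u0.

(* The quadratic form of exp (- tau Delta) - 1; for tau > 0 its terms are
   nonnegative and its value lies in [0, +oo]. *)
Definition inv_heat_form (tau : R) u : \bar R :=
  (((2 * pi) ^+ d)%:E *
   \esum_(k in [set: d.-tuple int])
      ((expR (tau * freq2 k) - 1) * fourier_norm2 u k)%:E)%E.

Definition potential (tau : R) (w : 'cV[R]_m) : R :=
  (2 * tau)^-1 * enorm w ^+ 2
  - expR tau / (tau * (expR (2 * tau) - 1))
    * ((1 + (expR (2 * tau) - 1) * enorm w ^+ 2) `^ 2^-1 - 1).

Definition modified_energy (tau : R) u : \bar R :=
  (((2 * tau)^-1)%:E * inv_heat_form tau u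
   + \int[torus_measure R d]_x (potential tau (u x))%:E)%E.

End fields.

(* Main.v *)
Require Import Defs.
From mathcomp Require Import all_boot all_order all_algebra.
From mathcomp Require Import all_classical all_reals all_analysis.
From mathcomp Require Import ess_sup_inf measurable_realfun.
From mathcomp Require Import complex.
From mathcomp.analysis Require showcase.summability.
From mathcomp Require Import finmap.
From mathcomp Require Import ring lra zify.

Set Implicit Arguments.
Unset Strict Implicit.
Unset Printing Implicit Defensive.

Import Order.TTheory GRing.Theory Num.Theory.
Import numFieldNormedType.Exports.

Local Open Scope classical_set_scope.
Local Open Scope ring_scope.

(** The maximum principle and the energy dissipation have independent proofs.

    Maximum principle. The heat evolution of a field u at a point x is a limit of
    averages of u against the Fejer means of the heat kernel. These means are
    nonnegative: they are products of one-dimensional means, and each of those is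
    a quadratic form with the Gaussian matrix exp(-t (j - l)^2), which is positive
    definite because exp(2 t j l) has a power series with nonnegative
    coefficients ([gauss_form_ge0], [theta_ge0]). The kernels have mean 1, so the
    heat flow does not increase the supremum of the Euclidean norm
    ([heat_enorm_le]); the reaction flow sends w to a vector of norm at most
    max(1, |w|) by direct computation ([reaction_enorm]).

    Energy dissipation. Write a and b for two consecutive smoothed iterates and w
    for the reaction flow applied to a, so that b = exp(tau Laplacian) w. The
    potential is |u|^2 / (2 tau) minus a convex function whose gradient at a is
    w / tau, hence
      2 tau (G(b) - G(a)) <= |b|^2 - |a|^2 - 2 <w, b - a>
    pointwise ([potential_step]). Integrate, and pass to Fourier coefficients by
    Parseval: as w has coefficients exp(tau |k|^2) b_k, the terms of the quadratic
    form combine with the right-hand side into - exp(tau |k|^2) |b_k - a_k|^2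
    ([modified_energy_le]).

    Parseval is only used when one factor is a heat evolution, whose Fourier
    series converges absolutely; it then follows from orthogonality of the
    characters and dominated convergence ([parseval_heat1]). All series are
    handled through finite sums over the boxes of frequencies |k_i| <= N, whose
    weighted limits give the unconditional sums ([sum_box_cvg]). *)

(** * Boxes of frequencies and positivity of the heat kernel *)

(** The interval [-N, N] of integers. It is listed with the pair N, -N added to
    the previous interval, so that sums over it telescope in N. *)
Fixpoint line (N : nat) : seq int :=
  if N is M.+1 then [:: (Posz M.+1), - (Posz M.+1) & line M] else [:: 0].

Fixpoint box (N d : nat) : seq (d.-tuple int) :=
  match d with
  | 0 => [:: [tuple]]
  | e.+1 => [seq cons_tuple a b | a <- line N, b <- box N e]
  end.

Lemma mem_line N (k : int) : (k \in line N) = (`|k|%N <= N)%N.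
Proof.
elim: N k => [|N IH] k /=; first by rewrite inE leqn0 absz_eq0.
by rewrite !inE IH; lia.
Qed.

Lemma line_uniq N : uniq (line N).
Proof.
elim: N => [//|N IH] /=; rewrite IH !inE !mem_line !negb_or.
by lia.
Qed.

Lemma mem_box N d (k : d.-tuple int) :
  (k \in box N d) = [forall i, (`|tnth k i| <= N)%N].
Proof.
elim: d k => [k|d IH k] /=.
  rewrite (tuple0 k) mem_seq1; transitivity true; first exact/eqP.
  by apply/esym/forallP => -[].
have [a [b ->]] : exists a b, k = cons_tuple a b.
  by exists (thead k), (behead_tuple k); rewrite {1}(tuple_eta k); apply: val_inj.
apply/allpairsP/forallP => [[[a' b'] /= [ha hb e]] i|h].
  have [-> ->] : a = a' /\ b = b'.
    by move/(congr1 val): e => /= [-> /val_inj ->].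
  case: (unliftP ord0 i) => [j ->|->].
    by rewrite tnthS; move: hb; rewrite IH => /forallP/(_ j).
  by rewrite tnth0 -mem_line.
exists (a, b) => /=; split => //.
  by move: (h ord0); rewrite tnth0 mem_line.
by rewrite IH; apply/forallP => j; move: (h (lift ord0 j)); rewrite tnthS.
Qed.

Lemma box_uniq N d : uniq (box N d).
Proof.
elim: d => [//|d IH] /=; apply: allpairs_uniq => //; first exact: line_uniq.
by move=> [a b] [a' b'] _ _ /= /(congr1 val) /= [-> /val_inj ->].
Qed.

Lemma box_mono N M d : (N <= M)%N -> {subset box N d <= box M d}.
Proof.
move=> NM k; rewrite !mem_box => /forallP h; apply/forallP => i.
exact: leq_trans (h i) NM.
Qed.

Lemma finite_sub_box d (A : seq (d.-tuple int)) :
  exists N, {subset A <= box N d}.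
Proof.
exists (\max_(k <- A) \max_(i < d) `|tnth k i|%N) => k kA.
rewrite mem_box; apply/forallP => i.
apply: leq_trans (leq_bigmax_seq (F := fun k => \max_(i < d) `|tnth k i|%N) k kA isT).
exact: (leq_bigmax (F := fun i => `|tnth k i|%N)).
Qed.

Section line_box_sums.
Variable (R : realType).

Lemma big_line (N : nat) (F : int -> R) :
  \sum_(k <- line N) F k =
  F 0 + \sum_(j < N) (F (Posz j.+1) + F (- Posz j.+1)).
Proof.
elim: N => [|N IH] /=; first by rewrite big_seq1 big_ord0 addr0.
by rewrite !big_cons IH big_ord_recr /=; ring.
Qed.

Lemma big_box (N d : nat) (F : d.+1.-tuple int -> R) :
  \sum_(k <- box N d.+1) F k =
  \sum_(a <- line N) \sum_(b <- box N d) F (cons_tuple a b).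
Proof. by rewrite /= big_allpairs_dep. Qed.

Lemma sum_line_odd (N : nat) (F : int -> R) : (forall k, F (- k) = - F k) ->
  \sum_(k <- line N) F k = 0.
Proof.
move=> oF; rewrite big_line big1 => [|j _]; last by rewrite oF subrr.
have := oF 0; rewrite oppr0 addr0 => /eqP.
by rewrite -addr_eq0 -mulr2n mulrn_eq0 => /eqP.
Qed.

(** Exactly N + 1 - |k| of the pairs (j, l) with j, l <= N have difference k:
    this is how a positive definite double sum produces Fejer weights. *)
Lemma fejer_sum (N : nat) (F : int -> R) :
  \sum_(j < N.+1) \sum_(l < N.+1) F (Posz j - Posz l) =
  \sum_(k <- line N) (N.+1%:R - `|k|%N%:R) * F k.
Proof.
elim: N => [|N IH].
  by rewrite !big_ord1 big_seq1 absz0 subrr subr0 mul1r.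
rewrite big_ord_recr /=; under eq_bigr do rewrite big_ord_recr /=.
rewrite big_split /= IH.
rewrite [RHS](_ : _ = \sum_(k <- line N.+1) (N.+1%:R - `|k|%N%:R) * F k
                      + \sum_(k <- line N.+1) F k); last first.
  by rewrite -big_split /=; apply: eq_bigr => k _; rewrite -[N.+2%:R]natr1; ring.
rewrite [in RHS]/= 2!big_cons -/(line N) absz_nat abszN absz_nat subrr !mul0r !add0r -addrA.
congr (_ + _); rewrite -[[:: _, _ & _]]/(line N.+1) big_line big_split /=.
rewrite [X in _ + X]big_ord_recr /= subrr addrA addrC; congr (_ + _); rewrite addrC.
congr (_ + _).
  rewrite (reindex_inj rev_ord_inj) /=; apply: eq_bigr => j _.
  by congr F; have := ltn_ord j; lia.
rewrite (reindex_inj rev_ord_inj) /=; apply: eq_bigr => j _.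
by congr F; have := ltn_ord j; lia.
Qed.

Lemma cvg_sumr (I T : Type) (F : set_system T) (FF : Filter F) (r : seq I)
    (f : I -> T -> R) (l : I -> R) : (forall i, f i x @[x --> F] --> l i) ->
  \sum_(i <- r) f i x @[x --> F] --> \sum_(i <- r) l i.
Proof. by move=> h; apply: cvg_big => //; exact: add_continuous. Qed.

(** The Gaussian is positive definite on the integers: factor its exponential
    as exp(-t j^2) exp(-t l^2) exp(2 t j l); in the power series of the last
    factor, the p-th term of the double sum is a nonnegative constant times a
    square. *)
Lemma gauss_form_ge0 (t : R) (N : nat) (g : nat -> R) : 0 <= t ->
  0 <= \sum_(j < N) \sum_(l < N)
         expR (- t * (Posz j - Posz l)%:~R ^+ 2) * (g j * g l).
Proof.
move=> t0; pose h (j : nat) := expR (- t * j%:R ^+ 2) * g j.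
have E (j l : nat) : expR (- t * (Posz j - Posz l)%:~R ^+ 2) * (g j * g l) =
    expR (2 * t * j%:R * l%:R) * (h j * h l).
  rewrite /h [RHS](_ : _ = expR (2 * t * j%:R * l%:R) * expR (- t * j%:R ^+ 2)
     * expR (- t * l%:R ^+ 2) * (g j * g l)); last by ring.
  by rewrite -!expRD; congr (expR _ * _); rewrite intrB -!pmulrn; ring.
under eq_bigr do under eq_bigr do rewrite E.
apply: (@cvgr_to_ge _ (\oo : set_system nat) _ _ (fun n => \sum_(j < N) \sum_(l < N)
   series (exp_coeff (2 * t * j%:R * l%:R)) n * (h j * h l))).
  apply: cvg_sumr => j; apply: cvg_sumr => l.
  by apply: cvgMl; exact: is_cvg_series_exp_coeff.
near=> n; rewrite /series /=.
rewrite (_ : (\sum_(j < N) _) = \sum_(0 <= p < n) (2 * t) ^+ p / p`!%:R *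
    (\sum_(j < N) j%:R ^+ p * h j) ^+ 2); last first.
  under eq_bigr do under eq_bigr do rewrite mulr_suml.
  under eq_bigr do rewrite exchange_big.
  rewrite exchange_big; apply: eq_bigr => p _ /=.
  rewrite expr2 mulr_suml mulr_sumr; apply: eq_bigr => j _ /=.
  rewrite !mulr_sumr; apply: eq_bigr => l _ /=.
  by rewrite /exp_coeff /= !exprMn; ring.
apply: sumr_ge0 => p _; apply: mulr_ge0; last exact: sqr_ge0.
by rewrite divr_ge0 // exprn_ge0 // mulr_ge0.
Unshelve. all: by end_near. Qed.

(** A Fejer mean of the periodic heat kernel on the circle. *)
Definition theta (t : R) (N : nat) (x : R) : R :=
  \sum_(k <- line N) (1 - `|k|%N%:R / N.+1%:R) * expR (- t * k%:~R ^+ 2)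
     * cos (k%:~R * x).

(** Fejer means keep positivity visible: the weighted sum is a Gaussian form in
    the vectors cos(j x) and sin(j x), by the subtraction formula for cosine.
    This is the source of the maximum principle. *)
Lemma theta_ge0 (t : R) (N : nat) (x : R) : 0 <= t -> 0 <= theta t N x.
Proof.
move=> t0.
have -> : theta t N x = N.+1%:R^-1 *
    (\sum_(j < N.+1) \sum_(l < N.+1)
         expR (- t * (Posz j - Posz l)%:~R ^+ 2) * (cos (j%:R * x) * cos (l%:R * x))
    + \sum_(j < N.+1) \sum_(l < N.+1)
         expR (- t * (Posz j - Posz l)%:~R ^+ 2) * (sin (j%:R * x) * sin (l%:R * x))).
  rewrite -big_split /=.
  rewrite [X in _ = _ * X](_ : _ = \sum_(j < N.+1) \sum_(l < N.+1)
     (fun k : int => expR (- t * k%:~R ^+ 2) * cos (k%:~R * x)) (Posz j - Posz l)).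
    rewrite (fejer_sum N (fun k : int => expR (- t * k%:~R ^+ 2) * cos (k%:~R * x))).
    rewrite mulr_sumr; apply: eq_bigr => k _.
    by rewrite !mulrA; congr (_ * _ * _); rewrite mulrBr mulVf // mulrC.
  apply: eq_bigr => j _; rewrite -big_split /=; apply: eq_bigr => l _.
  by rewrite -mulrDr intrB -!pmulrn mulrBl cosB.
rewrite mulr_ge0 // addr_ge0 //.
  exact: (@gauss_form_ge0 t N.+1 (fun j => cos (j%:R * x))).
exact: (@gauss_form_ge0 t N.+1 (fun j => sin (j%:R * x))).
Qed.

(** The sine part of cos(k x + c) is odd in k. *)
Lemma theta_shift (t : R) (N : nat) (x c : R) :
  \sum_(k <- line N) (1 - `|k|%N%:R / N.+1%:R) * expR (- t * k%:~R ^+ 2)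
     * cos (k%:~R * x + c) = theta t N x * cos c.
Proof.
rewrite /theta mulr_suml; apply/eqP; rewrite -subr_eq0 -sumrB; apply/eqP.
apply: sum_line_odd => k.
by rewrite abszN !mulrNz !mulNr sqrrN !cosD cosN sinN; ring.
Qed.

Definition fejer_weight (d N : nat) (k : d.-tuple int) : R :=
  \prod_(i < d) (1 - `|tnth k i|%N%:R / N.+1%:R).

Lemma freq2_cons d (a : int) (b : d.-tuple int) :
  freq2 R (cons_tuple a b) = a%:~R ^+ 2 + freq2 R b.
Proof.
rewrite /freq2 big_ord_recl tnth0; congr (_ + _); apply: eq_bigr => i _.
by rewrite tnthS.
Qed.

Lemma phase_cons d (a : int) (b : d.-tuple int) (x : Rspace R d.+1) :
  phase (cons_tuple a b) x =
  a%:~R * (tnth x ord0 : R) + phase b [tuple tnth x (lift ord0 i) | i < d].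
Proof.
rewrite /phase big_ord_recl tnth0; congr (_ + _); apply: eq_bigr => i _.
by rewrite tnthS tnth_mktuple.
Qed.

Lemma fejer_weight_cons d N (a : int) (b : d.-tuple int) :
  fejer_weight N (cons_tuple a b) = (1 - `|a|%N%:R / N.+1%:R) * fejer_weight N b.
Proof.
rewrite /fejer_weight big_ord_recl tnth0; congr (_ * _); apply: eq_bigr => i _.
by rewrite tnthS.
Qed.

(** The kernel on the d-torus is the product of the kernels on its circles. The
    shift c is what makes the induction on d go through: at each step the phase
    of the split-off coordinate is absorbed into it. *)
Lemma box_kernel_prod d (t : R) (N : nat) (x : Rspace R d) (c : R) :
  \sum_(k <- box N d) fejer_weight N k * expR (- t * freq2 R k) * cos (phase k x + c)
  = (\prod_(i < d) theta t N (tnth x i)) * cos c.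
Proof.
elim: d x c => [x c|d IH x c].
  by rewrite /= big_seq1 /fejer_weight /freq2 /phase !big_ord0 mulr0 expR0 !mul1r add0r.
rewrite big_box big_ord_recl.
under eq_bigr => a _.
  under eq_bigr => b _.
    rewrite fejer_weight_cons freq2_cons phase_cons mulrDr expRD.
    rewrite (addrC (_ * _) (phase _ _)) -addrA.
    over.
  over.
transitivity (\sum_(a <- line N) (1 - `|a|%N%:R / N.+1%:R) * expR (- t * a%:~R ^+ 2) *
   \sum_(b <- box N d) fejer_weight N b * expR (- t * freq2 R b) *
    cos (phase b [tuple tnth x (lift ord0 i) | i < d] + (a%:~R * (tnth x ord0 : R) + c))).
  apply: eq_bigr => a _; rewrite mulr_sumr; apply: eq_bigr => b _; ring.
under eq_bigr do rewrite IH mulrCA.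
rewrite -mulr_sumr theta_shift mulrCA mulrA; congr (_ * _ * _).
by apply: eq_bigr => i _; rewrite tnth_mktuple.
Qed.

Lemma phaseBr d (k : d.-tuple int) (x y : Rspace R d) :
  phase k x - phase k y = phase k ([tuple (tnth x i : R) - tnth y i | i < d] : Rspace R d).
Proof.
rewrite /phase -sumrB; apply: eq_bigr => i _.
by rewrite tnth_mktuple mulrBr.
Qed.

Lemma box_kernel_ge0 d (t : R) (N : nat) (x y : Rspace R d) : 0 <= t ->
  0 <= \sum_(k <- box N d) fejer_weight N k * expR (- t * freq2 R k)
         * cos (phase k x - phase k y).
Proof.
move=> t0; under eq_bigr do rewrite phaseBr -[phase _ _]addr0.
by rewrite box_kernel_prod cos0 mulr1 prodr_ge0 // => i _; exact: theta_ge0.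
Qed.

Lemma fejer_weight01 d N (k : d.-tuple int) : k \in box N d -> 0 <= fejer_weight N k <= 1.
Proof.
rewrite mem_box => /forallP h; apply/andP; split.
  apply: prodr_ge0 => i _; rewrite subr_ge0 ler_pdivrMr // mul1r ler_nat.
  exact: leqW.
apply: prodr_ile1 => i _; rewrite subr_ge0 ler_pdivrMr // mul1r ler_nat leqW //=.
Qed.

Lemma fejer_weight0 d N : fejer_weight N (nseq_tuple d 0) = 1.
Proof. by rewrite /fejer_weight big1 // => i _; rewrite tnth_nseq mul0r subr0. Qed.

Lemma cvg_fejer_weight d (k : d.-tuple int) : fejer_weight N k @[N --> \oo] --> (1 : R).
Proof.
rewrite /fejer_weight [X in _ --> X](_ : _ = \prod_(i < d) 1 :> R); last by rewrite big1.
apply: cvg_big => [|i _]; first exact: mul_continuous.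
rewrite -[X in _ --> X]subr0; apply: cvgB; first exact: cvg_cst.
rewrite -(mulr0 `|tnth k i|%N%:R : _ = 0 :> R).
apply: cvgMr; exact: cvg_harmonic.
Qed.

(** In one dimension exp(-t k^2) <= exp(-t |k|) compares the sum with a geometric
    series; the sum over a box is a power of the sum over a line. *)
Lemma gauss_box_bound d (t : R) : 0 < t ->
  exists C : R, forall N, \sum_(k <- box N d) expR (- t * freq2 R k) <= C.
Proof.
move=> t0; pose q := expR (- t); have q1 : q < 1 by rewrite expR_lt1 oppr_lt0.
have q0 : 0 <= q := expR_ge0 _.
have line_bound N : \sum_(a <- line N) expR (- t * a%:~R ^+ 2) <= 1 + 2 / (1 - q).
  rewrite big_line expr0n mulr0 expR0 lerD2l.
  rewrite ler_pdivlMr ?subr_gt0 //.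
  apply: (@le_trans _ _ (2 * (\sum_(j < N) q ^+ j) * (1 - q))).
    rewrite ler_wpM2r ?subr_ge0 ?(ltW q1) // mulr_sumr ler_sum // => j _.
    rewrite mulrNz sqrrN -mulr2n mulr_natl lerMn2r /=.
    rewrite -expRM_natr ler_expR 2!mulNr lerN2 ler_pM2l //.
    by rewrite -pmulrn -natrX ler_nat; nia.
  rewrite -mulrA [X in 2 * X]mulrC -[1 - q]opprB mulNr -subrX1 opprB.
  by rewrite mulr_natl ler_pMn2r // gerBl exprn_ge0.
elim: d => [|d [C IH]].
  by exists 1 => N; rewrite /= big_seq1 /freq2 big_ord0 mulr0 expR0.
exists ((1 + 2 / (1 - q)) * C) => N; rewrite big_box.
under eq_bigr do under eq_bigr do rewrite freq2_cons mulrDr expRD.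
under eq_bigr do rewrite -mulr_sumr.
rewrite -mulr_suml ler_pM // sumr_ge0 // => *; exact: expR_ge0.
Qed.

End line_box_sums.

(** * Unconditional sums along boxes *)

Section unconditional_sums.
#[local] Existing Instance summability.totally_filter.
Variables (R : realType) (d : nat).
Implicit Types f : d.-tuple int -> R.

Lemma ler_sum_uniq_sub (I : eqType) (s t : seq I) (f : I -> R) :
  uniq s -> uniq t -> {subset s <= t} -> (forall k, 0 <= f k) ->
  \sum_(k <- s) f k <= \sum_(k <- t) f k.
Proof.
move=> us ut st f0; rewrite [leRHS](bigID (mem s)) /=.
rewrite -[X in _ <= X + _]big_filter [X in _ <= X + _](perm_big s) /=; last first.
  apply: uniq_perm => //; first exact: filter_uniq.
  by move=> k; rewrite mem_filter /=; case: (boolP (k \in s)) => //= /st ->.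
by rewrite lerDl sumr_ge0.
Qed.

Lemma partial_sumE f (A : {fset d.-tuple int}) :
  summability.partial_sum (f : _ -> R^o) A = \sum_(k <- A) f k.
Proof. by rewrite /summability.partial_sum big_seq_fsetE. Qed.

Variables (W : nat -> d.-tuple int -> R).
Hypothesis W01 : forall N k, k \in box N d -> 0 <= W N k <= 1.
Hypothesis W1 : forall k, W N k @[N --> \oo] --> (1 : R).

(** A Tannery argument: the common limit is the supremum of the finite sums. The
    weighted sums stay below it because the weights are at most 1, and on a
    finite set that nearly attains it the weights tend to 1. *)
Lemma nonneg_sum_cvg f (C : R) : (forall k, 0 <= f k) ->
  (forall N, \sum_(k <- box N d) f k <= C) ->
  exists L : R,
     ((fun A : {fset d.-tuple int} => \sum_(k <- A) f k) @ summability.totally --> L) /\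
     (\sum_(k <- box N d) W N k * f k @[N --> \oo] --> L).
Proof.
move=> f0 fC; pose S := [set (\sum_(k <- A) f k) | A in [set: {fset d.-tuple int}]].
have Sle (A : seq (d.-tuple int)) : uniq A -> \sum_(k <- A) f k <= C.
  move=> uA; have [N AN] := finite_sub_box A.
  exact: le_trans (ler_sum_uniq_sub uA (box_uniq _ _) AN f0) (fC N).
have hS : has_sup S.
  split; first by exists (\sum_(k <- (fset0 : {fset d.-tuple int})) f k); exists fset0.
  by exists C => _ [A _ <-]; apply: Sle; exact: fset_uniq.
have leS (A : seq (d.-tuple int)) : uniq A -> \sum_(k <- A) f k <= sup S.
  move=> uA; apply: sup_upper_bound => //; exists [fset k in A]%fset => //.
  apply: perm_big; apply: uniq_perm => // k.
  by rewrite inE.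
exists (sup S); split.
  apply/cvgrPdist_le => e e0.
  have [_ [A _ <-] hA] := sup_adherent e0 hS.
  exists A => // B AB /=; rewrite ler_distl.
  have hB := leS _ (fset_uniq B).
  have hAB : \sum_(k <- A) f k <= \sum_(k <- B) f k.
    apply: ler_sum_uniq_sub => // k; exact: (fsubsetP AB).
  by apply/andP; split; lra.
apply/cvgrPdist_le => e e0.
have e2 : 0 < e / 2 by rewrite divr_gt0.
have [_ [A _ <-] hA] := sup_adherent e2 hS.
have [M AM] := finite_sub_box A.
have : \sum_(k <- A) W N k * f k @[N --> \oo] --> \sum_(k <- A) f k.
  apply: cvg_sumr => k; rewrite -[X in _ --> X]mul1r.
  by apply: cvgMl; exact: W1.
move/cvgrPdist_le => /(_ _ e2) hW; near=> N.
have MN : (M <= N)%N by near: N; exact: nbhs_infty_ge.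
have : `|\sum_(k <- A) f k - \sum_(k <- A) W N k * f k| <= e / 2 by near: N.
rewrite !ler_distl => /andP[h1 h2].
have hN : \sum_(k <- box N d) W N k * f k <= sup S.
  apply: le_trans (leS _ (box_uniq N d)); rewrite [leLHS]big_seq [leRHS]big_seq.
  by apply: ler_sum => k /W01 /andP[w0 w1]; rewrite ler_piMl.
pose W' N k := if k \in box N d then W N k else 0.
have : \sum_(k <- A) W N k * f k <= \sum_(k <- box N d) W N k * f k.
  rewrite [leLHS](_ : _ = \sum_(k <- A) W' N k * f k); last first.
    rewrite [LHS]big_seq [RHS]big_seq; apply: eq_bigr => k kA.
    by rewrite /W' (box_mono MN (AM _ kA)).
  rewrite [leRHS](_ : _ = \sum_(k <- box N d) W' N k * f k); last first.
    by rewrite [LHS]big_seq [RHS]big_seq; apply: eq_bigr => k; rewrite /W' => ->.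
  apply: ler_sum_uniq_sub; [exact: fset_uniq|exact: box_uniq| |].
    by move=> k /AM /(box_mono MN).
  by move=> k; rewrite /W' mulr_ge0 //; case: ifPn => // /W01 /andP[].
by move=> h3; apply/andP; split; lra.
Unshelve. all: by end_near. Qed.

(** Unconditional summation of an absolutely bounded family can be computed along
    boxes, with any weights in [0, 1] tending to 1. The weight 1 gives
    measurability and Parseval; Fejer weights give positivity. *)
Lemma sum_box_cvg f (C : R) :
  (forall N, \sum_(k <- box N d) `|f k| <= C) ->
  \sum_(k <- box N d) W N k * f k @[N --> \oo]
    --> summability.sum (f : _ -> R^o).
Proof.
move=> fC.
pose p k := (`|f k| + f k) / 2; pose q k := (`|f k| - f k) / 2.
have p0 k : 0 <= p k by rewrite /p; have := ler_norm (- f k); rewrite normrN; lra.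
have q0 k : 0 <= q k by rewrite /q; have := ler_norm (f k); lra.
have fE k : f k = p k - q k by rewrite /p /q; lra.
have [|L1 [hL1 hL1']] := @nonneg_sum_cvg p C p0.
  move=> N; apply: le_trans (fC N); apply: ler_sum => k _.
  by rewrite /p; have := ler_norm (f k); lra.
have [|L2 [hL2 hL2']] := @nonneg_sum_cvg q C q0.
  move=> N; apply: le_trans (fC N); apply: ler_sum => k _.
  by rewrite /q; have := ler_norm (- f k); rewrite normrN; lra.
have -> : summability.sum (f : _ -> R^o) = L1 - L2.
  apply: cvg_lim => //.
  rewrite (_ : summability.partial_sum _ = fun A : {fset d.-tuple int} =>
     \sum_(k <- A) p k - \sum_(k <- A) q k); first exact: cvgB.
  apply/funext => A; rewrite partial_sumE -sumrB; apply: eq_bigr => k _; exact: fE.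
rewrite (_ : (fun N => _) = fun N : nat =>
     \sum_(k <- box N d) W N k * p k - \sum_(k <- box N d) W N k * q k).
  exact: cvgB.
apply/funext => A; rewrite -sumrB; apply: eq_bigr => k _; rewrite fE; ring.
Qed.

End unconditional_sums.

(** * Integration over the torus *)

Section torus_integral.
Variable R : realType.
Local Notation mu := (torus_measure R).

Lemma bounded_integrable (disp : measure_display) (T : measurableType disp)
    (m : {finite_measure set T -> \bar R}) (f : T -> R) (M : R) :
  measurable_fun setT f -> (forall x, `|f x| <= M) ->
  m.-integrable setT (EFin \o f).
Proof.
move=> mf fM; apply: measurable_bounded_integrable => //.
  by rewrite ltey_eq fin_num_measure.
exists M; split; first exact: num_real.
by move=> y My x _ /=; rewrite (le_trans (fM x)) // ltW.
Qed.

Lemma circle_Rintegral (f : measurableTypeR R -> R) (M : R) :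
  measurable_fun setT f -> (forall x, `|f x| <= M) ->
  \int[circle_measure R]_x f x =
  \int[lebesgue_measure]_(x in `[- (pi : R), pi]) f x.
Proof.
move=> mf fM; rewrite /Rintegral; congr fine.
have mD : measurable (`[- (pi : R), pi] : set (measurableTypeR R)).
  exact: measurable_itv.
pose C : set (measurableTypeR R) := ~` `[- (pi : R), pi].
have mC : measurable C by exact: measurableC.
transitivity (\int[circle_measure R]_(x in setT `\` C) (f x)%:E)%E; last first.
- rewrite setDE setCK setTI; apply: eq_measure_integral => A mA AD.
  by rewrite -[LHS]/(lebesgue_measure (A `&` `[- (pi : R), pi])) setIidl.
- apply: negligible_integral => //; first exact: bounded_integrable mf fM.
  by rewrite -[LHS]/(lebesgue_measure (C `&` `[- (pi : R), pi])) setICl measure0.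
Qed.

(** Fubini for the recursive construction of the torus measure. *)
Lemma torus_RintegralS d (f : Rspace R d.+1 -> R) (M : R) :
  measurable_fun setT f -> (forall x, `|f x| <= M) ->
  \int[mu d.+1]_x f x =
  \int[circle_measure R]_a \int[mu d]_b f (tcons (a, b)).
Proof.
move=> mf fM.
have mft : measurable_fun setT (f \o (@tcons R d)).
  exact: measurableT_comp mf (@measurable_tcons R d).
have ift : (circle_measure R \x mu d)%E.-integrable setT (EFin \o (f \o (@tcons R d))).
  apply: measurable_bounded_integrable => //.
    have h : (mu d.+1 setT < +oo)%E by rewrite ltey_eq fin_num_measure.
    exact: h.
  exists M; split; first exact: num_real.
  by move=> y My x _ /=; rewrite (le_trans (fM _)) // ltW.
rewrite {1}/Rintegral.
have -> : (\int[mu d.+1]_x (f x)%:E)%E =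
  (\int[circle_measure R \x mu d]_z (f (tcons z))%:E)%E.
  rewrite -[RHS](@integral_pushforward _ _ _ _ R _ (@measurable_tcons R d)
     (circle_measure R \x mu d)%E setT (EFin \o f)) //.
  exact/measurable_EFinP.
rewrite -(integral12_prod_meas1 ift) /Rintegral; congr fine.
apply: eq_integral => a _; rewrite /fubini_F /= fineK //.
apply: integrable_fin_num => //.
apply: (@bounded_integrable _ _ _ (fun y => f (tcons (a, y))) M) => //.
exact: (measurableT_comp mft (pair1_measurable a)).
Qed.

Lemma is_derive_cosine_primitive (k : R) (c x : R) : k != 0 ->
  is_derive x 1 (fun a => k^-1 * sin (k * a + c)) (cos (k * x + c)).
Proof.
move=> k0; apply: is_derive_eq.
by rewrite addr0 /GRing.scale /= mulr1; field.
Qed.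

Lemma continuous_cos_affine (k c : R) : continuous (fun a : R => cos (k * a + c)).
Proof.
move=> x.
apply: (@continuous_comp _ _ _ (fun a => k * a + c) cos); last exact: continuous_cos.
by apply: cvgD; [apply: cvgMr; exact: cvg_id|exact: cvg_cst].
Qed.

Lemma measurable_cos_affine (k c : R) :
  measurable_fun [set: measurableTypeR R] (fun a : measurableTypeR R => cos (k * (a : R) + c)).
Proof.
apply: continuous_measurable_fun; exact: continuous_cos_affine.
Qed.

Lemma circle_int_cos (k : int) (c : R) :
  \int[circle_measure R]_a cos (k%:~R * (a : R) + c) =
  (k == 0)%:R * (2 * pi) * cos c.
Proof.
rewrite (@circle_Rintegral _ 1); last first.
- by move=> x; exact: cos_max.
- exact: measurable_cos_affine.
have ppi : - pi < pi :> R by have := pi_gt0 R; lra.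
case: eqVneq => [->|k0].
  under eq_Rintegral do rewrite mul0r add0r.
  rewrite Rintegral_cst //= mul1r mulrC.
  by rewrite lebesgue_measure_itv /= lte_fin ppi /= opprK -mulr2n mulr_natl.
have kR : (k%:~R : R) != 0 by rewrite intr_eq0.
rewrite mul0r mul0r /Rintegral.
rewrite (@continuous_FTC2 _ _ (fun a => k%:~R^-1 * sin (k%:~R * a + c))) //.
- rewrite -EFinB /= -mulrBr mulrN !sinD cosN sinN.
  have -> : sin (k%:~R * pi) = 0 :> R.
    have hn (n : nat) : sin (n%:R * pi) = 0 :> R.
      elim: n => [|n IH]; first by rewrite mul0r sin0.
      by rewrite -natr1 mulrDl mul1r sinDpi IH oppr0.
    by case: (intP k) => [|n|n]; rewrite ?mulrNz ?mulNr ?sinN ?hn ?oppr0 // mul0r sin0.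
  by rewrite oppr0 mul0r subrr mulr0.
- by apply: continuous_subspaceT; exact: continuous_cos_affine.
- have cF : continuous (fun a : R => k%:~R^-1 * sin (k%:~R * a + c)).
    move=> x; apply: differentiable_continuous; apply/derivable1_diffP.
    by have [] := @is_derive_cosine_primitive k%:~R c x kR.
  split.
  + by move=> x _; have [] := @is_derive_cosine_primitive k%:~R c x kR.
  + by apply: cvg_at_right_filter; exact: cF.
  + by apply: cvg_at_left_filter; exact: cF.
- move=> x _; rewrite derive1E.
  by have [] := @is_derive_cosine_primitive k%:~R c x kR.
Qed.

Lemma measurable_phase d (k : d.-tuple int) :
  measurable_fun [set: Rspace R d] (phase k : Rspace R d -> R).
Proof.
apply: measurable_sum => i; apply: measurable_funM; first exact: measurable_cst.
exact: (measurable_tnth (T := measurableTypeR R)).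
Qed.

Lemma measurable_cos_phase d (k : d.-tuple int) (c : R) :
  measurable_fun [set: Rspace R d] (fun x : Rspace R d => cos (phase k x + c)).
Proof.
apply: (measurableT_comp (continuous_measurable_fun (@continuous_cos R))).
apply: measurable_funD; [exact: measurable_phase|exact: measurable_cst].
Qed.

Lemma phase_tcons d (a0 : int) (k : d.-tuple int) (a : measurableTypeR R) (b : Rspace R d) :
  phase (cons_tuple a0 k) (tcons (a, b)) = a0%:~R * (a : R) + phase k b.
Proof.
rewrite phase_cons; congr (_ * _ + phase _ _).
by apply: eq_from_tnth => i; rewrite tnth_mktuple tnthS.
Qed.

(** Orthogonality of the characters, in a real form. The shift c covers cosines
    and sines at once, and makes the induction on d possible. *)
Lemma torus_int_cos d (k : d.-tuple int) (c : R) :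
  \int[mu d]_x cos (phase k x + c) =
  (k == nseq_tuple d 0)%:R * (2 * pi) ^+ d * cos c.
Proof.
elim: d k c => [k c|d IH k c].
  have -> : (k == nseq_tuple 0 0) = true by apply/eqP; rewrite [LHS]tuple0 [RHS]tuple0.
  rewrite expr0 !mul1r -[c in RHS]add0r.
  rewrite -[X in X + c](_ : phase k ([tuple] : Rspace R 0) = 0); last first.
    by rewrite /phase big_ord0.
  rewrite /Rintegral /= integral_dirac //; last first.
    by apply/measurable_EFinP; exact: measurable_cos_phase.
  by rewrite diracT mul1e.
have [a0 [k' ->]] : exists a b, k = cons_tuple a b.
  by exists (thead k), (behead_tuple k); rewrite {1}(tuple_eta k); apply: val_inj.
rewrite (@torus_RintegralS _ _ 1); last first.
- by move=> x; exact: cos_max.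
- exact: measurable_cos_phase.
transitivity (\int[circle_measure R]_a
   ((k' == nseq_tuple d 0)%:R * (2 * pi) ^+ d * cos (a0%:~R * (a : R) + c))).
  apply: eq_Rintegral => a _; rewrite -IH; apply: eq_Rintegral => b _.
  by rewrite phase_tcons [_ + phase _ _]addrC addrA.
rewrite RintegralZl //; last first.
  apply: (@bounded_integrable _ _ _ _ 1); first exact: measurable_cos_affine.
  by move=> x; exact: cos_max.
rewrite circle_int_cos.
have -> : (cons_tuple a0 k' == nseq_tuple d.+1 0) = (a0 == 0) && (k' == nseq_tuple d 0).
  by [].
by rewrite exprS; case: eqP => _; case: eqP => _; rewrite ?(mul0r, mulr0, mul1r) //; ring.
Qed.

End torus_integral.

(** * Real Fourier coefficients *)

Section fourier_modes.
Variables (R : realType) (d : nat).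
Local Notation T := (Rspace R d).
Local Notation mu := (torus_measure R d).
Implicit Types (f g : T -> R) (k : d.-tuple int).

Definition torus_integrable f := mu.-integrable setT (EFin \o f).

Lemma torus_integrable_measurable f : torus_integrable f -> measurable_fun setT f.
Proof. by move=> /integrableP[/measurable_EFinP]. Qed.

Lemma torus_integrableM f g (M : R) : torus_integrable f ->
  measurable_fun setT g -> (forall x, `|g x| <= M) ->
  torus_integrable (fun x => f x * g x).
Proof.
move=> fi mg gM; apply: (@integrableMl _ _ _ mu setT _ (EFin \o f) g) => //.
exists M; split; first exact: num_real.
by move=> y My x _ /=; rewrite (le_trans (gM x)) // ltW.
Qed.

Lemma torus_integrableD f g : torus_integrable f -> torus_integrable g ->
  torus_integrable (fun x => f x + g x).
Proof. by move=> fi gi; exact: integrableD fi gi. Qed.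

Lemma torus_integrableZ (c : R) f : torus_integrable f ->
  torus_integrable (fun x => c * f x).
Proof. by move=> fi; exact: integrableZl fi. Qed.

Lemma torus_integrable_sum (I : Type) (s : seq I) (F : I -> T -> R) :
  (forall i, torus_integrable (F i)) ->
  torus_integrable (fun x => \sum_(i <- s) F i x).
Proof.
move=> Fi; rewrite /torus_integrable.
rewrite (_ : _ \o _ = fun x => (\sum_(i <- s) (F i x)%:E)%E); last first.
  by apply/funext => x /=; rewrite sumEFin.
by apply: integrable_sum => // i _; exact: Fi.
Qed.

Lemma torus_Rintegral_sum (I : Type) (s : seq I) (F : I -> T -> R) :
  (forall i, torus_integrable (F i)) ->
  \int[mu]_x (\sum_(i <- s) F i x) = \sum_(i <- s) \int[mu]_x F i x.
Proof.
move=> Fi; elim: s => [|i s IH].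
  under eq_Rintegral do rewrite big_nil.
  by rewrite big_nil Rintegral_cst // mul0r.
under eq_Rintegral do rewrite big_cons.
rewrite RintegralD //; [by rewrite IH big_cons|exact: Fi|exact: torus_integrable_sum].
Qed.

(** A function that is nonnegative almost everywhere agrees almost everywhere with
    its absolute value. *)
Lemma ae_Rintegral_ge0 f : measurable_fun setT f ->
  (\forall x \ae mu, 0 <= f x) -> 0 <= \int[mu]_x f x.
Proof.
move=> mf f0.
have -> : \int[mu]_x f x = \int[mu]_x `|f x|.
  rewrite /Rintegral; congr fine; apply: ae_eq_integral => //.
  - exact/measurable_EFinP.
  - by apply/measurable_EFinP; exact: measurableT_comp.
  - by apply: filterS f0 => x fx _ /=; rewrite ger0_norm.
by apply: Rintegral_ge0 => x _.
Qed.

Definition torus_mean f : R := (2 * pi) ^- d * \int[mu]_x f x.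

(** [fcos] and [fsin] are the real part and minus the imaginary part of the
    Fourier coefficient. *)
Definition fcos f k : R := torus_mean (fun x => f x * cos (phase k x)).
Definition fsin f k : R := torus_mean (fun x => f x * sin (phase k x)).

(** For a real function, the real part of (Fourier coefficient times character). *)
Definition fourier_mode f k (x : T) : R :=
  fcos f k * cos (phase k x) + fsin f k * sin (phase k x).

Lemma torus_volume_gt0 : 0 < (2 * pi : R) ^+ d.
Proof. by rewrite exprn_gt0 // mulr_gt0 // pi_gt0. Qed.

Lemma measurable_cosp k : measurable_fun setT (fun x : T => cos (phase k x)).
Proof.
have := @measurable_cos_phase R d k 0.
by rewrite (_ : (fun x => cos (phase k x + 0)) = fun x => cos (phase k x)) //;
  apply/funext => x; rewrite addr0.
Qed.

Lemma measurable_sinp k : measurable_fun setT (fun x : T => sin (phase k x)).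
Proof.
have := @measurable_cos_phase R d k (- (pi / 2)).
by rewrite (_ : (fun x => cos (phase k x - pi / 2)) = fun x => sin (phase k x)) //;
  apply/funext => x; rewrite cosBpihalf.
Qed.

Lemma integrable_cosp f k : torus_integrable f ->
  torus_integrable (fun x => f x * cos (phase k x)).
Proof.
move=> fi; apply: (torus_integrableM (M := 1)) => //; first exact: measurable_cosp.
by move=> x; exact: cos_max.
Qed.

Lemma integrable_sinp f k : torus_integrable f ->
  torus_integrable (fun x => f x * sin (phase k x)).
Proof.
move=> fi; apply: (torus_integrableM (M := 1)) => //; first exact: measurable_sinp.
by move=> x; exact: sin_max.
Qed.

Lemma fourier_mode_mean f k (x : T) : torus_integrable f ->
  fourier_mode f k x = torus_mean (fun y => f y * cos (phase k x - phase k y)).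
Proof.
move=> fi; rewrite /fourier_mode /fcos /fsin /torus_mean -!mulrA -mulrDr; congr (_ * _).
have hc : mu.-integrable setT (EFin \o _) := integrable_cosp k fi.
have hs : mu.-integrable setT (EFin \o _) := integrable_sinp k fi.
rewrite -!RintegralZr //.
rewrite -RintegralD //; last 2 first.
- have := torus_integrableZ (cos (phase k x)) (integrable_cosp k fi).
  by under eq_fun do rewrite mulrC.
- have := torus_integrableZ (sin (phase k x)) (integrable_sinp k fi).
  by under eq_fun do rewrite mulrC.
by apply: eq_Rintegral => y _; rewrite cosB; ring.
Qed.

Lemma mean_mul_le f g : torus_integrable f -> measurable_fun setT g ->
  (forall x, `|g x| <= 1) ->
  `|torus_mean (fun x => f x * g x)| <= torus_mean (fun x => `|f x|).
Proof.
move=> fi mg g1.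
have fgi : torus_integrable (fun x => f x * g x) := torus_integrableM fi mg g1.
rewrite /torus_mean normrM ger0_norm ?invr_ge0 ?(ltW torus_volume_gt0) //.
rewrite ler_wpM2l ?invr_ge0 ?(ltW torus_volume_gt0) //.
apply: le_trans (le_normr_Rintegral _ fgi) _ => //.
apply: le_Rintegral => //.
- exact: (integrable_norm fgi).
- exact: (integrable_norm fi).
by move=> x _ /=; rewrite normrM ler_piMr.
Qed.

Lemma fourier_mode_le f k (x : T) : torus_integrable f ->
  `|fourier_mode f k x| <= torus_mean (fun x => `|f x|) * 2.
Proof.
move=> fi; rewrite mulr2n mulrDr mulr1 /fourier_mode (le_trans (ler_normD _ _)) //.
rewrite (normrM (fcos _ _)) (normrM (fsin _ _)).
have h (u v w : R) : 0 <= v -> 0 <= u -> u <= w -> v <= 1 -> u * v <= w.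
  by move=> v0 u0 uw v1; rewrite (le_trans _ uw) // ler_piMr.
apply: lerD; apply: h => //; rewrite ?cos_max ?sin_max //; apply: mean_mul_le => //.
- exact: measurable_cosp.
- by move=> y; exact: cos_max.
- exact: measurable_sinp.
- by move=> y; exact: sin_max.
Qed.

Lemma measurable_fourier_mode f k : measurable_fun setT (fourier_mode f k).
Proof.
apply: measurable_funD; apply: measurable_funM => //.
  exact: measurable_cosp.
exact: measurable_sinp.
Qed.

End fourier_modes.

Section fourier_coefficients.
Variables (R : realType) (d m : nat).
Local Notation T := (Rspace R d).
Implicit Types (u : T -> 'cV[R]_m) (k : d.-tuple int).

Lemma Re_fourier u k (j : 'I_m) :
  complex.Re (fourier u k j) = fcos (fun x => u x j ord0) k.
Proof.
rewrite /fourier /fcos /torus_mean /= mul0r subr0; congr (_ * _).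
by apply: eq_Rintegral => x _; rewrite /= mul0r subr0 cosN.
Qed.

Lemma Im_fourier u k (j : 'I_m) : torus_integrable (fun x => u x j ord0) ->
  complex.Im (fourier u k j) = - fsin (fun x => u x j ord0) k.
Proof.
move=> ui; rewrite /fourier /fsin /torus_mean /= mul0r addr0 -mulrN; congr (_ * _).
rewrite -mulN1r -RintegralZl //; last exact: integrable_sinp.
by apply: eq_Rintegral => x _; rewrite /= mul0r addr0 sinN; ring.
Qed.

Lemma fourier_norm2E u k : (forall j, torus_integrable (fun x => u x j ord0)) ->
  fourier_norm2 u k =
  \sum_(j < m) (fcos (fun x => u x j ord0) k ^+ 2 + fsin (fun x => u x j ord0) k ^+ 2).
Proof.
by move=> ui; apply: eq_bigr => j _; rewrite Re_fourier Im_fourier // sqrrN.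
Qed.

(** Each component of a heat evolution depends on that component alone. *)
Definition heat1 (t : R) (f : T -> R) (x : T) : R :=
  summability.sum (fun k : d.-tuple int => expR (- t * freq2 R k) * fourier_mode f k x : R^o).

Lemma heatE (t : R) u (x : T) (j : 'I_m) : torus_integrable (fun x => u x j ord0) ->
  heat t u x j ord0 = heat1 t (fun x => u x j ord0) x.
Proof.
move=> ui; rewrite /heat mxE /heat1; congr summability.sum; apply/funext => k.
have ReM (z : R[i]) (s : R) :
    complex.Re (z * expi s) = complex.Re z * cos s - complex.Im z * sin s.
  by case: z.
by rewrite ReM Re_fourier Im_fourier // (mulNr (fsin _ _)) opprK.
Qed.

Lemma L2_integrable u : L2 u -> forall j, torus_integrable (fun x => u x j ord0).
Proof.
move=> uL j; apply/Lfun1_integrable; apply: Lfun_subset12 (uL j).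
exact: fin_num_measure.
Qed.

End fourier_coefficients.

(** * The heat semigroup on scalar functions *)

Section heat_flow.
Variables (R : realType) (d : nat).
Local Notation T := (Rspace R d).
Local Notation mu := (torus_measure R d).
Variable t : R.
Hypothesis t0 : 0 < t.
Implicit Types (f g : T -> R) (k : d.-tuple int).

Definition heat_term f (x : T) k : R := expR (- t * freq2 R k) * fourier_mode f k x.

Lemma heat_term_bound f : torus_integrable f ->
  exists B : R, forall x N, \sum_(k <- box N d) `|heat_term f x k| <= B.
Proof.
move=> fi; have [C hC] := gauss_box_bound d t0.
exists (C * (torus_mean (fun x => `|f x|) * 2)) => x N.
have M0 : 0 <= torus_mean (fun x => `|f x|) * 2.
  exact: le_trans (normr_ge0 _) (fourier_mode_le (nseq_tuple d 0) x fi).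
apply: (@le_trans _ _ (\sum_(k <- box N d) expR (- t * freq2 R k) *
   (torus_mean (fun x => `|f x|) * 2))).
  apply: ler_sum => k _; rewrite /heat_term normrM (ger0_norm (expR_ge0 _)).
  by rewrite ler_wpM2l ?expR_ge0 // fourier_mode_le.
by rewrite -mulr_suml ler_wpM2r.
Qed.

Lemma heat1_cvg (W : nat -> d.-tuple int -> R) f (x : T) :
  (forall N k, k \in box N d -> 0 <= W N k <= 1) ->
  (forall k, W N k @[N --> \oo] --> (1 : R)) -> torus_integrable f ->
  \sum_(k <- box N d) W N k * heat_term f x k @[N --> \oo] --> heat1 t f x.
Proof.
move=> W01 W1 fi; have [B hB] := heat_term_bound fi.
exact: (sum_box_cvg W01 W1 (hB x)).
Qed.

Lemma heat1_box_cvg f (x : T) : torus_integrable f ->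
  \sum_(k <- box N d) heat_term f x k @[N --> \oo] --> heat1 t f x.
Proof.
move=> fi; rewrite (_ : (fun N => _) =
    fun N => \sum_(k <- box N d) 1 * heat_term f x k); last first.
  by apply/funext => N; apply: eq_bigr => k _; rewrite mul1r.
apply: (@heat1_cvg (fun _ _ => 1)) => // [N k _|k]; first by rewrite ler01 lexx.
exact: cvg_cst.
Qed.

Lemma heat1_bound f : torus_integrable f ->
  exists B : R, (forall x N, `|\sum_(k <- box N d) heat_term f x k| <= B) /\
    forall x, `|heat1 t f x| <= B.
Proof.
move=> fi; have [B hB] := heat_term_bound fi.
have h x N : `|\sum_(k <- box N d) heat_term f x k| <= B.
  exact: le_trans (ler_norm_sum _ _ _) (hB x N).
exists B; split=> // x.
have hc : `|\sum_(k <- box N d) heat_term f x k| @[N --> \oo] --> `|heat1 t f x|.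
  exact: cvg_norm (@heat1_box_cvg f x fi).
apply: (cvgr_to_le hc).
by near=> N; exact: h.
Unshelve. all: by end_near. Qed.

Lemma measurable_heat_sum f N :
  measurable_fun setT (fun x : T => \sum_(k <- box N d) heat_term f x k).
Proof.
apply: measurable_sum => k; apply: measurable_funM => //.
exact: measurable_fourier_mode.
Qed.

Lemma measurable_heat1 f : torus_integrable f -> measurable_fun setT (heat1 t f).
Proof.
move=> fi; apply: (measurable_fun_cvg (h := fun N x => \sum_(k <- box N d) heat_term f x k)).
  by move=> N; exact: measurable_heat_sum.
by move=> x _; exact: heat1_box_cvg.
Qed.

Lemma integrable_heat1 f : torus_integrable f -> torus_integrable (heat1 t f).
Proof.
move=> fi; have [B [_ hB]] := heat1_bound fi.
exact: bounded_integrable (measurable_heat1 fi) hB.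
Qed.

(** The partial sums of the heat series are uniformly bounded, so dominated
    convergence exchanges sum and integral. *)
Lemma parseval_heat1 w f : torus_integrable w -> torus_integrable f ->
  \sum_(k <- box N d) expR (- t * freq2 R k) *
      (fcos w k * fcos f k + fsin w k * fsin f k) @[N --> \oo]
  --> torus_mean (fun x => w x * heat1 t f x).
Proof.
move=> wi fi; have [B [hBN hB]] := heat1_bound fi.
rewrite (_ : (fun N => _) = fun N =>
   torus_mean (fun x => w x * \sum_(k <- box N d) heat_term f x k)); last first.
  apply/funext => N; rewrite /torus_mean.
  under eq_Rintegral do rewrite mulr_sumr.
  rewrite torus_Rintegral_sum; last first.
    move=> k.
    apply: (torus_integrableM (M := expR (- t * freq2 R k) *
      (torus_mean (fun x => `|f x|) * 2))) => //.
      by apply: measurable_funM => //; exact: measurable_fourier_mode.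
    by move=> x; rewrite normrM (ger0_norm (expR_ge0 _)) ler_wpM2l ?expR_ge0 // fourier_mode_le.
  rewrite mulr_sumr; apply: eq_bigr => k _.
  rewrite /heat_term /fourier_mode.
  have hc : mu.-integrable setT (EFin \o _) := integrable_cosp k wi.
  have hs : mu.-integrable setT (EFin \o _) := integrable_sinp k wi.
  rewrite [X in _ = _ * X](_ : _ = \int[mu]_x (expR (- t * freq2 R k) * fcos f k *
      (w x * cos (phase k x)) + expR (- t * freq2 R k) * fsin f k * (w x * sin (phase k x)))).
    rewrite RintegralD //; [|exact: torus_integrableZ hc|exact: torus_integrableZ hs].
    rewrite !RintegralZl //; rewrite /fcos /fsin /torus_mean; ring.
  by apply: eq_Rintegral => x _; ring.
apply: cvgMr; rewrite /Rintegral; apply: fine_cvg.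
rewrite fineK; last first.
  apply: integrable_fin_num => //; apply: (torus_integrableM (M := B)) => //.
  exact: measurable_heat1.
have mw := torus_integrable_measurable wi.
have := @dominated_convergence _ _ R mu setT measurableT
  (fun N x => (w x * \sum_(k <- box N d) heat_term f x k)%:E)
  (fun x => (w x * heat1 t f x)%:E) (fun x => (B * `|w x|)%:E).
case => //.
- move=> N; apply/measurable_EFinP; apply: measurable_funM => //.
  exact: measurable_heat_sum.
- by apply/measurable_EFinP; apply: measurable_funM => //; exact: measurable_heat1.
- apply: aeW => x _; apply: cvg_EFin; first by near=> N.
  by apply: cvgMr; exact: heat1_box_cvg.
- exact: (torus_integrableZ B (integrable_norm wi)).
- by apply: aeW => x N _; rewrite lee_fin normrM mulrC ler_wpM2r.
Unshelve. all: by end_near. Qed.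

Definition freqN k : d.-tuple int := [tuple - tnth k i | i < d].

Lemma phaseN k (x : T) : phase (freqN k) x = - phase k x.
Proof.
by rewrite /phase -sumrN; apply: eq_bigr => i _; rewrite tnth_mktuple mulrNz mulNr.
Qed.

Lemma freq2N k : freq2 R (freqN k) = freq2 R k.
Proof. by apply: eq_bigr => i _; rewrite tnth_mktuple mulrNz sqrrN. Qed.

Lemma fcosN f k : fcos f (freqN k) = fcos f k.
Proof.
by rewrite /fcos; congr (_ * _); apply: eq_Rintegral => x _; rewrite phaseN cosN.
Qed.

Lemma fsinN f k : torus_integrable f -> fsin f (freqN k) = - fsin f k.
Proof.
move=> fi; rewrite /fsin /torus_mean -mulrN; congr (_ * _).
rewrite -mulN1r -RintegralZl //; last exact: integrable_sinp.
by apply: eq_Rintegral => x _; rewrite phaseN sinN; ring.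
Qed.

Definition freqB k l : d.-tuple int := [tuple tnth k i - tnth l i | i < d].

Lemma phaseBl k l (x : T) : phase (freqB k l) x = phase k x - phase l x.
Proof.
rewrite /phase -sumrB; apply: eq_bigr => i _.
by rewrite tnth_mktuple intrB mulrBl.
Qed.

Lemma freqB_eq0 k l : (freqB k l == nseq_tuple d 0) = (k == l).
Proof.
apply/eqP/eqP => [qE|->]; apply: eq_from_tnth => i.
  apply/eqP; rewrite -subr_eq0.
  by move/(congr1 (fun z => tnth z i)): qE; rewrite tnth_mktuple tnth_nseq => ->.
by rewrite tnth_mktuple tnth_nseq subrr.
Qed.

Lemma integrable_cos_shift k (c : R) : torus_integrable (fun x : T => cos (phase k x + c)).
Proof.
apply: (@bounded_integrable _ _ _ _ _ 1); first exact: measurable_cos_phase.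
by move=> x; exact: cos_max.
Qed.

Lemma torus_mean_cos k (c : R) :
  torus_mean (fun x : T => cos (phase k x + c)) = (k == nseq_tuple d 0)%:R * cos c.
Proof.
rewrite /torus_mean torus_int_cos [_ * (2 * pi) ^+ d]mulrC !mulrA mulVf ?mul1r //.
by rewrite gt_eqF // torus_volume_gt0.
Qed.

Lemma torus_mean_coscos k l (c1 c2 : R) :
  torus_mean (fun x : T => cos (phase l x + c1) * cos (phase k x + c2)) =
  ((k == l)%:R * cos (c2 - c1) + (k == freqN l)%:R * cos (c2 + c1)) / 2.
Proof.
rewrite -(freqB_eq0 k l) -(freqB_eq0 k (freqN l)) -!torus_mean_cos.
rewrite /torus_mean -mulrDr -mulrA; congr (_ * _).
have hi q c : mu.-integrable setT (EFin \o _) := integrable_cos_shift q c.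
rewrite -RintegralD // -RintegralZr //; last exact: (integrableD measurableT (hi _ _) (hi _ _)).
apply: eq_Rintegral => x _; rewrite !phaseBl phaseN opprK !cosD !sinD !cosN !sinN.
by field.
Qed.

Lemma sum_box_delta N l (F : d.-tuple int -> R) : l \in box N d ->
  \sum_(k <- box N d) (k == l)%:R * F k = F l.
Proof.
move=> lN; rewrite (bigD1_seq l) ?box_uniq //= eqxx mul1r big1 ?addr0 // => k.
by move=> /negbTE ->; rewrite mul0r.
Qed.

Lemma near_box l : \forall N \near \oo, l \in box N d.
Proof.
have [M hM] := finite_sub_box [:: l].
near=> N; apply: (@box_mono M); last by apply: hM; rewrite inE.
by near: N; exact: nbhs_infty_ge.
Unshelve. all: by end_near. Qed.

(** Parseval against a single shifted character: orthogonality leaves only the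
    frequencies l and -l, whose contributions agree because f is real. Taking
    c = 0 and c = - pi / 2 shows that the heat semigroup is diagonal. *)
Lemma torus_mean_cos_heat1 l f (c : R) : torus_integrable f ->
  torus_mean (fun x => cos (phase l x + c) * heat1 t f x) =
  expR (- t * freq2 R l) * (cos c * fcos f l - sin c * fsin f l).
Proof.
move=> fi; apply: (cvg_unique _ (parseval_heat1 (integrable_cos_shift l c) fi)) => //.
apply: cvg_near_cst; near=> N.
have lN : l \in box N d by near: N; exact: near_box.
have lN' : freqN l \in box N d by near: N; exact: near_box.
rewrite (eq_bigr (fun k => (k == l)%:R * (expR (- t * freq2 R k) *
     (cos c * fcos f k - sin c * fsin f k) / 2) + (k == freqN l)%:R *
     (expR (- t * freq2 R k) * (cos c * fcos f k + sin c * fsin f k) / 2))).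
  by rewrite big_split /= !sum_box_delta // freq2N fcosN fsinN //; field.
move=> k _; have -> : fcos (fun x => cos (phase l x + c)) k =
    ((k == l)%:R * cos c + (k == freqN l)%:R * cos c) / 2.
  have := torus_mean_coscos k l c 0; rewrite sub0r add0r cosN => <-.
  by rewrite /fcos; congr (_ * _); apply: eq_Rintegral => x _; rewrite addr0.
have -> : fsin (fun x => cos (phase l x + c)) k =
    (- (k == l)%:R * sin c + (k == freqN l)%:R * sin c) / 2.
  have := torus_mean_coscos k l c (- (pi / 2)).
  have -> : cos (- (pi / 2) - c) = - sin c by rewrite -opprD cosN addrC cosDpihalf.
  rewrite [- _ + c]addrC cosBpihalf mulrN -mulNr => <-.
  by rewrite /fsin; congr (_ * _); apply: eq_Rintegral => x _; rewrite cosBpihalf.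
by field.
Unshelve. all: by end_near. Qed.

Lemma fcos_heat1 l f : torus_integrable f ->
  fcos (heat1 t f) l = expR (- t * freq2 R l) * fcos f l.
Proof.
move=> fi; have := torus_mean_cos_heat1 l 0 fi.
rewrite cos0 sin0 mul0r subr0 mul1r => <-.
by congr (_ * _); apply: eq_Rintegral => x _; rewrite addr0 mulrC.
Qed.

Lemma fsin_heat1 l f : torus_integrable f ->
  fsin (heat1 t f) l = expR (- t * freq2 R l) * fsin f l.
Proof.
move=> fi; have := torus_mean_cos_heat1 l (- (pi / 2)) fi.
rewrite cosN sinN cos_pihalf sin_pihalf mul0r sub0r mulN1r opprK => <-.
by congr (_ * _); apply: eq_Rintegral => x _; rewrite cosBpihalf mulrC.
Qed.

End heat_flow.

(** * The maximum principle *)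

Section euclidean.
Variables (R : realType) (m : nat).
Implicit Types a b : 'cV[R]_m.

Lemma inner_ge0 a : 0 <= inner a a.
Proof. by apply: sumr_ge0 => i _; rewrite -expr2 sqr_ge0. Qed.

Lemma sqr_enorm a : enorm a ^+ 2 = inner a a.
Proof. by rewrite sqr_sqrtr // inner_ge0. Qed.

Lemma enorm_ge0 a : 0 <= enorm a.
Proof. exact: sqrtr_ge0. Qed.

Lemma innerZ (c : R) a : inner (c *: a) (c *: a) = c ^+ 2 * inner a a.
Proof.
by rewrite /inner mulr_sumr; apply: eq_bigr => i _; rewrite !mxE; ring.
Qed.

(** Cauchy-Schwarz, from the Lagrange identity. *)
Lemma inner_sqr_le a b : inner a b ^+ 2 <= inner a a * inner b b.
Proof.
rewrite -subr_ge0 -(@pmulr_rge0 _ 2) //.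
rewrite [X in _ <= X](_ : _ = \sum_i \sum_j (a i ord0 * b j ord0 - a j ord0 * b i ord0) ^+ 2).
  by apply: sumr_ge0 => i _; apply: sumr_ge0 => j _; exact: sqr_ge0.
have -> : 2 * (inner a a * inner b b - inner a b ^+ 2) =
   inner a a * inner b b + inner b b * inner a a - 2 * (inner a b * inner a b) by ring.
rewrite {1 2 3 4 5 6}/inner !mulr_suml -big_split mulr_sumr -sumrB; apply: eq_bigr => i _ /=.
rewrite !mulr_sumr -big_split -sumrB; apply: eq_bigr => j _ /=.
ring.
Qed.

Lemma inner_le_enorm a b : inner a b <= enorm a * enorm b.
Proof.
rewrite (le_trans (ler_norm _)) // -(@ler_pXn2r _ 2) ?nnegrE ?mulr_ge0 ?enorm_ge0 //.
by rewrite exprMn !sqr_enorm real_normK ?num_real // inner_sqr_le.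
Qed.

(** With r = |w|, E = exp tau and M = max(1, r), the claim reads
    E^2 r^2 <= M^2 ((E^2 - 1) r^2 + 1), which follows from M^2 >= 1 and
    M^2 >= r^2 after writing E^2 r^2 = (E^2 - 1) r^2 + r^2. *)
Lemma reaction_enorm (tau : R) (w : 'cV[R]_m) : 0 < tau ->
  enorm (reaction tau w) <= Num.max 1 (enorm w).
Proof.
move=> tau0; set M := Num.max 1 (enorm w).
have M1 : 1 <= M by rewrite /M le_max lexx.
have Mw : enorm w <= M by rewrite /M le_max lexx orbT.
have e1 : 1 < expR tau by rewrite expR_gt1.
have e2 : expR (2 * tau) = expR tau ^+ 2 by rewrite mulrC expRM_natr.
rewrite -(@ler_pXn2r _ 2) ?nnegrE ?enorm_ge0 //; last exact: le_trans M1.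
rewrite sqr_enorm /reaction innerZ -sqr_enorm.
set r := enorm w in Mw *; set E := expR tau in e1 e2 *.
rewrite e2.
have D0 : 0 < (E ^+ 2 - 1) * r ^+ 2 + 1.
  by rewrite ltr_wpDl // mulr_ge0 ?sqr_ge0 // subr_ge0 exprn_ege1 // ltW.
rewrite powRN powR12_sqrt; last exact: ltW.
rewrite exprMn exprVn sqr_sqrtr ?(ltW D0) // -mulrA mulrC ler_pdivrMr //.
have p0 : 0 <= (E ^+ 2 - 1) * r ^+ 2.
  by rewrite mulr_ge0 ?sqr_ge0 // subr_ge0 exprn_ege1 // ltW.
rewrite mulrDr mulr1 [leLHS](_ : _ = (E ^+ 2 - 1) * r ^+ 2 + r ^+ 2); last by ring.
apply: lerD; first by rewrite ler_peMl // exprn_ege1.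
by rewrite lerXn2r ?nnegrE ?enorm_ge0 // (le_trans ler01).
Qed.

End euclidean.

Section maximum_principle.
Variables (R : realType) (d m : nat).
Local Notation T := (Rspace R d).
Local Notation mu := (torus_measure R d).
Variable t : R.
Hypothesis t0 : 0 < t.
Implicit Types (f : T -> R) (u : T -> 'cV[R]_m).

Definition box_heat_kernel N (x y : T) : R :=
  \sum_(k <- box N d) fejer_weight R N k * expR (- t * freq2 R k)
     * cos (phase k x - phase k y).

Lemma box_heat_kernel_bounded N (x y : T) :
  `|box_heat_kernel N x y| <= \sum_(k <- box N d) `|fejer_weight R N k * expR (- t * freq2 R k)|.
Proof.
apply: le_trans (ler_norm_sum _ _ _) _; apply: ler_sum => k _.
by rewrite normrM ler_piMr // cos_max.
Qed.

Lemma measurable_box_heat_kernel N (x : T) :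
  measurable_fun setT (box_heat_kernel N x).
Proof.
apply: measurable_sum => k; apply: measurable_funM => //.
rewrite (_ : (fun y => _) = fun y : T => cos (phase k y + - phase k x)).
  exact: measurable_cos_phase.
by apply/funext => y; rewrite -cosN opprB.
Qed.

Lemma integrable_box_heat_kernel f N (x : T) : torus_integrable f ->
  torus_integrable (fun y => f y * box_heat_kernel N x y).
Proof.
move=> fi; apply: torus_integrableM fi (measurable_box_heat_kernel N x) _.
exact: box_heat_kernel_bounded.
Qed.

(** Fejer means of the heat evolution are averages against the kernel. *)
Lemma mean_box_heat_kernel f N (x : T) : torus_integrable f ->
  torus_mean (fun y => f y * box_heat_kernel N x y) =
  \sum_(k <- box N d) fejer_weight R N k * heat_term t f x k.
Proof.
move=> fi; rewrite /torus_mean /box_heat_kernel.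
have ci k : torus_integrable (fun y : T => f y * cos (phase k x - phase k y)).
  apply: (torus_integrableM (M := 1)) => //; last by move=> y; exact: cos_max.
  rewrite (_ : (fun y => _) = fun y : T => cos (phase k y + - phase k x)).
    exact: measurable_cos_phase.
  by apply/funext => y; rewrite -cosN opprB.
under eq_Rintegral do rewrite mulr_sumr.
rewrite torus_Rintegral_sum; last first.
  move=> k; have := torus_integrableZ (fejer_weight R N k * expR (- t * freq2 R k)) (ci k).
  by under eq_fun do rewrite mulrCA.
rewrite mulr_sumr; apply: eq_bigr => k _; rewrite /heat_term fourier_mode_mean // /torus_mean.
rewrite (_ : \int[mu]_y (f y * (fejer_weight R N k * _ * _)) =
    fejer_weight R N k * expR (- t * freq2 R k) *
    \int[mu]_y (f y * cos (phase k x - phase k y))); first by ring.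
rewrite -RintegralZl //; last exact: ci.
by apply: eq_Rintegral => y _; ring.
Qed.

(** Only the zero frequency has a nonzero mean. *)
Lemma mean_box_heat_kernel1 N (x : T) : torus_mean (box_heat_kernel N x) = 1.
Proof.
have c1 : torus_integrable (fun _ : T => 1 : R).
  by apply: (@bounded_integrable _ _ _ _ _ 1) => // y; rewrite normr1.
transitivity (torus_mean (fun y => 1 * box_heat_kernel N x y)).
  by congr (_ * _); apply: eq_Rintegral => y _; rewrite mul1r.
rewrite mean_box_heat_kernel //.
rewrite (eq_bigr (fun k => (k == nseq_tuple d 0)%:R * (fejer_weight R N k *
    (expR (- t * freq2 R k) * cos (phase k x))))).
  have f0 : freq2 R (nseq_tuple d 0) = 0.
    by rewrite /freq2 big1 // => i _; rewrite tnth_nseq expr0n.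
  have p0 : phase (nseq_tuple d 0) x = 0.
    by rewrite /phase big1 // => i _; rewrite tnth_nseq mul0r.
  rewrite sum_box_delta ?fejer_weight0 ?f0 ?p0 ?mulr0 ?expR0 ?cos0 ?mulr1 //.
  by rewrite mem_box; apply/forallP => i; rewrite tnth_nseq.
move=> k _; rewrite /heat_term fourier_mode_mean //.
rewrite (_ : torus_mean _ = (k == nseq_tuple d 0)%:R * cos (phase k x)); first by ring.
rewrite -cosN -torus_mean_cos; congr (_ * _); apply: eq_Rintegral => y _.
by rewrite mul1r -cosN opprB.
Qed.

(** Duality: with h the value of the evolved field at x, the number <h, h> is the
    limit of the averages of <h, u> against nonnegative kernels of mean 1, and
    <h, u> <= |h| M almost everywhere. Testing against h itself avoids choosing
    a direction in the target space. *)
Lemma heat_enorm_le u (M : R) (x : T) : 0 <= M ->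
  (forall j, torus_integrable (fun y => u y j ord0)) ->
  (\forall y \ae mu, enorm (u y) <= M) -> enorm (heat t u x) <= M.
Proof.
move=> M0 ui uM; set h := heat t u x.
(* The division by |h| needs h <> 0; for h = 0 the bound is M >= 0. *)
suff hh : inner h h <= enorm h * M.
  have [-> //|h0] := eqVneq (enorm h) 0.
  have hp : 0 < enorm h by rewrite lt_def h0 enorm_ge0.
  by move: hh; rewrite -sqr_enorm expr2 ler_pM2l.
have cv : \sum_(j < m) h j ord0 * (\sum_(k <- box N d)
     fejer_weight R N k * heat_term t (fun y => u y j ord0) x k) @[N --> \oo] --> inner h h.
  apply: cvg_sumr => j; apply: cvgMr; rewrite /h heatE //.
  by apply: heat1_cvg => // [N k|k]; [exact: fejer_weight01|exact: cvg_fejer_weight].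
apply: (cvgr_to_le cv); near=> N.
under eq_bigr do rewrite -mean_box_heat_kernel //.
have Ki : torus_integrable (box_heat_kernel N x).
  apply: bounded_integrable (box_heat_kernel_bounded N x).
  exact: measurable_box_heat_kernel.
pose g y := enorm h * M * box_heat_kernel N x y -
  \sum_(j < m) h j ord0 * (u y j ord0 * box_heat_kernel N x y).
have si : torus_integrable (fun y =>
   \sum_(j < m) h j ord0 * (u y j ord0 * box_heat_kernel N x y)).
  apply: torus_integrable_sum => j; apply: torus_integrableZ.
  exact: integrable_box_heat_kernel.
have ci := torus_integrableZ (enorm h * M) Ki.
rewrite -subr_ge0 (_ : _ - _ = torus_mean g).
  rewrite /torus_mean mulr_ge0 ?invr_ge0 ?(ltW (torus_volume_gt0 _ _)) //.
  apply: ae_Rintegral_ge0.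
    by apply: measurable_funB; exact: torus_integrable_measurable.
  apply: filterS uM => y uy; rewrite /g.
  under eq_bigr do rewrite mulrA.
  rewrite -mulr_suml -mulrBl mulr_ge0 //; last exact: box_kernel_ge0 (ltW t0).
  rewrite subr_ge0; apply: le_trans (inner_le_enorm h (u y)) _.
  by rewrite ler_wpM2l // enorm_ge0.
rewrite /torus_mean RintegralB // mulrBr RintegralZl //.
rewrite [X in _ = _ - _ * X]torus_Rintegral_sum; last first.
  by move=> j; apply: torus_integrableZ; exact: integrable_box_heat_kernel.
rewrite mulr_sumr mulrCA -/(torus_mean _) mean_box_heat_kernel1 mulr1; congr (_ - _).
apply: eq_bigr => j _; rewrite RintegralZl //; last exact: integrable_box_heat_kernel.
by rewrite /torus_mean mulrCA.
Unshelve. all: by end_near. Qed.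

End maximum_principle.

(** * Convexity of the potential *)

Section pointwise_energy.
Variables (R : realType) (m : nat) (tau : R).
Hypothesis tau0 : 0 < tau.
Implicit Types a b : 'cV[R]_m.

Local Notation alpha := (expR (2 * tau) - 1).

Lemma expR_double_sub1_gt0 : 0 < alpha.
Proof. by rewrite subr_gt0 expR_gt1 mulr_gt0. Qed.

(** A rescaled Japanese bracket. It is the denominator of the reaction flow and,
    up to an affine change of its value, the convex function that the potential
    subtracts from its quadratic part. *)
Definition bracket a : R := Num.sqrt (1 + alpha * inner a a).

Lemma bracket_gt0 a : 0 < bracket a.
Proof. by rewrite sqrtr_gt0 ltr_wpDr // mulr_ge0 ?inner_ge0 // ltW ?expR_double_sub1_gt0. Qed.

Lemma sqr_bracket a : bracket a ^+ 2 = 1 + alpha * inner a a.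
Proof. by rewrite sqr_sqrtr // addr_ge0 // mulr_ge0 ?inner_ge0 // ltW ?expR_double_sub1_gt0. Qed.

(** Cauchy-Schwarz for the vectors (1, sqrt alpha a) and (1, sqrt alpha b), with
    alpha = exp(2 tau) - 1. *)
Lemma bracket_mul_ge a b : 1 + alpha * inner a b <= bracket a * bracket b.
Proof.
have al := expR_double_sub1_gt0.
rewrite (le_trans (ler_norm _)) //.
rewrite -(@ler_pXn2r _ 2) ?nnegrE ?mulr_ge0 ?(ltW (bracket_gt0 _)) //.
rewrite exprMn !sqr_bracket real_normK ?num_real //.
have h1 := inner_sqr_le a b.
have h2 : 2 * inner a b <= inner a a + inner b b.
  rewrite -subr_ge0 (_ : _ - _ = \sum_i (a i ord0 - b i ord0) ^+ 2).
    by apply: sumr_ge0 => i _; exact: sqr_ge0.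
  rewrite /inner mulr_sumr -big_split -sumrB; apply: eq_bigr => i _ /=; ring.
rewrite -subr_ge0 (_ : _ - _ = alpha * (inner a a + inner b b - 2 * inner a b) +
   alpha ^+ 2 * (inner a a * inner b b - inner a b ^+ 2)); last by ring.
by apply: addr_ge0; apply: mulr_ge0; rewrite ?exprn_ge0 ?(ltW al) // subr_ge0.
Qed.

Lemma potentialE a : potential tau a =
  (2 * tau)^-1 * inner a a - expR tau / (tau * alpha) * (bracket a - 1).
Proof.
rewrite /potential sqr_enorm powR12_sqrt // addr_ge0 // mulr_ge0 ?inner_ge0 //.
exact: ltW expR_double_sub1_gt0.
Qed.

Lemma reactionE a : reaction tau a = (expR tau / bracket a) *: a.
Proof.
rewrite /reaction powRN sqr_enorm addrC powR12_sqrt; first by rewrite mulrC.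
by rewrite addr_ge0 // mulr_ge0 ?inner_ge0 // ltW ?expR_double_sub1_gt0.
Qed.

(** The graph of the convex function [bracket] lies above its tangent at a, whose
    slope is a multiple of the reaction flow at a. The quadratic part of the
    potential contributes the difference of the squares exactly. *)
Lemma potential_step a b :
  potential tau b <= potential tau a + (2 * tau)^-1 *
    (inner b b - inner a a - 2 * inner (reaction tau a) b
     + 2 * inner (reaction tau a) a).
Proof.
have iZ (c : R) x : inner (c *: a) x = c * inner a x.
  by rewrite /inner mulr_sumr; apply: eq_bigr => i _; rewrite mxE mulrA.
rewrite !potentialE reactionE !iZ.
have al := expR_double_sub1_gt0; have ra := bracket_gt0 a.
have := bracket_mul_ge a b; have := sqr_bracket a.
set ra' := bracket a in ra *; set rb := bracket b.
set al' := alpha in al *; set aa := inner a a; set ab := inner a b => h1 h2.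
rewrite -subr_ge0.
rewrite (_ : _ - _ = expR tau / (tau * al' * ra') *
  (ra' * rb - ra' ^+ 2 - al' * ab + al' * aa)); last first.
  by field; rewrite !gt_eqF.
rewrite mulr_ge0 ?divr_ge0 ?expR_ge0 ?mulr_ge0 ?(ltW ra) ?(ltW al) ?(ltW tau0) //.
rewrite h1; lra.
Qed.

End pointwise_energy.

(** * Dissipation of the modified energy *)

Section energy.
Variables (R : realType) (d m : nat).
Local Notation T := (Rspace R d).
Local Notation mu := (torus_measure R d).
Implicit Types (f g : T -> R) (u v w a b : T -> 'cV[R]_m) (k : d.-tuple int).

Definition field_integrable u := forall j, torus_integrable (fun x => u x j ord0).

(** The real part of the Hermitian product of two Fourier coefficients. *)
Definition coef_dot f g k : R := fcos f k * fcos g k + fsin f k * fsin g k.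

Lemma heat_coord (t : R) u j : field_integrable u ->
  (fun x => heat t u x j ord0) = heat1 t (fun x => u x j ord0).
Proof. by move=> ui; apply/funext => x; exact: heatE. Qed.

Lemma integrable_heat (t : R) u : 0 < t -> field_integrable u ->
  field_integrable (heat t u).
Proof. by move=> t0 ui j; rewrite heat_coord //; exact: integrable_heat1. Qed.

Lemma integrable_mul_heat (t : R) w v j : 0 < t ->
  field_integrable w -> field_integrable v ->
  torus_integrable (fun x => w x j ord0 * heat t v x j ord0).
Proof.
move=> t0 wi vi; have [B [_ hB]] := heat1_bound t0 (vi j).
apply: (torus_integrableM (M := B)) => //.
  exact: torus_integrable_measurable (integrable_heat t0 vi j).
by move=> x; rewrite heatE.
Qed.

Lemma measurable_inner u v : field_integrable u -> field_integrable v ->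
  measurable_fun setT (fun x => inner (u x) (v x)).
Proof.
move=> ui vi; apply: measurable_sum => j.
by apply: measurable_funM; exact: torus_integrable_measurable.
Qed.

Lemma measurable_bracket (tau : R) u : field_integrable u ->
  measurable_fun setT (fun x => bracket tau (u x)).
Proof.
move=> ui; apply: (measurableT_comp (continuous_measurable_fun (@sqrt_continuous R))).
apply: measurable_funD => //; apply: measurable_funM => //.
exact: measurable_inner.
Qed.

(** Since [bracket] is at least 1, the reaction flow multiplies a field by a factor
    bounded by exp tau. *)
Lemma integrable_reaction (tau : R) u : 0 < tau -> field_integrable u ->
  field_integrable (fun x => reaction tau (u x)).
Proof.
move=> tau0 ui j.
rewrite (_ : (fun x => _) = fun x => u x j ord0 * (expR tau / bracket tau (u x))); last first.
  by apply/funext => x; rewrite reactionE // mxE mulrC.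
have r1 x : 1 <= bracket tau (u x).
  rewrite -[leLHS]sqrtr1 ler_wsqrtr // lerDl mulr_ge0 ?inner_ge0 //.
  exact: ltW (expR_double_sub1_gt0 tau0).
apply: (torus_integrableM (M := expR tau)) => //.
  apply: measurable_funM => //.
  rewrite (_ : (fun x => _) = fun x => bracket tau (u x) `^ (-1)).
    by apply: (measurableT_comp (@measurable_powR R (-1))); exact: measurable_bracket.
  by apply/funext => x; rewrite powR_inv1 // sqrtr_ge0.
move=> x; rewrite normrM (ger0_norm (expR_ge0 _)) ger0_norm ?invr_ge0 ?sqrtr_ge0 //.
by rewrite ler_piMr ?expR_ge0 // invf_le1 // (lt_le_trans ltr01).
Qed.

Lemma heat_inner_bound (t : R) u : 0 < t -> field_integrable u ->
  exists Q : R, forall x, inner (heat t u x) (heat t u x) <= Q.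
Proof.
move=> t0 ui.
have h j : {B : R | forall x, `|heat1 t (fun x => u x j ord0) x| <= B}.
  by apply: cid; have [B [_ hB]] := heat1_bound t0 (ui j); exists B.
exists (\sum_(j < m) sval (h j) ^+ 2) => x; apply: ler_sum => j _.
rewrite heatE // -expr2 -[leLHS]ger0_norm ?sqr_ge0 // normrX.
rewrite lerXn2r ?nnegrE //; last exact: (svalP (h j)).
exact: le_trans (normr_ge0 _) (svalP (h j) x).
Qed.

Lemma EFin_torus_Rintegral f : torus_integrable f ->
  (\int[mu]_x (f x)%:E)%E = (\int[mu]_x f x)%:E.
Proof. by move=> fi; rewrite /Rintegral fineK //; exact: integrable_fin_num fi. Qed.

Lemma integrable_potential (tau t : R) u : 0 < tau -> 0 < t -> field_integrable u ->
  torus_integrable (fun x => potential tau (heat t u x)).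
Proof.
move=> tau0 t0 ui; have [Q hQ] := heat_inner_bound t0 ui.
have hi := integrable_heat t0 ui.
have al := expR_double_sub1_gt0 tau0.
rewrite (_ : (fun x => _) = fun x => (2 * tau)^-1 * inner (heat t u x) (heat t u x)
   - expR tau / (tau * (expR (2 * tau) - 1)) * (bracket tau (heat t u x) - 1)); last first.
  by apply/funext => x; rewrite potentialE.
apply: (@bounded_integrable _ _ _ _ _ ((2 * tau)^-1 * Q +
   expR tau / (tau * (expR (2 * tau) - 1)) * (Num.sqrt (1 + (expR (2 * tau) - 1) * Q) + 1))).
  apply: measurable_funB; apply: measurable_funM => //; first exact: measurable_inner.
  by apply: measurable_funB => //; exact: measurable_bracket.
move=> x; rewrite (le_trans (ler_normB _ _)) // !normrM; apply: lerD.
  rewrite ger0_norm ?invr_ge0 ?mulr_ge0 ?(ltW tau0) // ler_wpM2l ?invr_ge0 ?mulr_ge0 ?(ltW tau0) //.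
  by rewrite ger0_norm ?inner_ge0.
have c0 : 0 <= expR tau / (tau * (expR (2 * tau) - 1)).
  by rewrite divr_ge0 ?expR_ge0 // mulr_ge0 // ltW.
rewrite -(normrM (expR tau)) (ger0_norm c0) ler_wpM2l //.
rewrite (le_trans (ler_normB _ _)) // normr1 lerD2r ger0_norm ?sqrtr_ge0 //.
by rewrite ler_wsqrtr // lerD2l ler_wpM2l // ltW.
Qed.

Lemma parseval_heat (t : R) w v : 0 < t -> field_integrable w -> field_integrable v ->
  \sum_(k <- box N d) \sum_(j < m)
     coef_dot (fun x => w x j ord0) (fun x => heat t v x j ord0) k @[N --> \oo]
  --> torus_mean (fun x => inner (w x) (heat t v x)).
Proof.
move=> t0 wi vi; rewrite (_ : torus_mean _ = \sum_(j < m)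
    torus_mean (fun x => w x j ord0 * heat t v x j ord0)).
  rewrite (_ : (fun N => _) = fun N => \sum_(j < m) \sum_(k <- box N d)
     coef_dot (fun x => w x j ord0) (fun x => heat t v x j ord0) k); last first.
    by apply/funext => N; rewrite exchange_big.
  apply: cvg_sumr => j; have := parseval_heat1 t0 (wi j) (vi j).
  rewrite (heat_coord t j vi).
  rewrite [X in _ -> X @ _ --> _](_ : _ = fun N => \sum_(k <- box N d)
    expR (- t * freq2 R k) * (fcos (fun x => w x j ord0) k * fcos (fun x => v x j ord0) k +
      fsin (fun x => w x j ord0) k * fsin (fun x => v x j ord0) k)); last first.
    apply/funext => N; apply: eq_bigr => k _.
    rewrite /coef_dot fcos_heat1 // fsin_heat1 //; ring.
  rewrite (_ : (fun x => w x j ord0 * heat t v x j ord0) =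
    fun x => w x j ord0 * heat1 t (fun x => v x j ord0) x) //.
  by apply/funext => x; rewrite heatE.
rewrite /torus_mean -mulr_sumr -torus_Rintegral_sum // => j.
exact: integrable_mul_heat.
Qed.

(** Up to the factor 1 / (2 tau), a pointwise upper bound for the increase of the
    potential from a to b when w is the reaction flow applied to a. *)
Definition energy_gap a b w (x : T) : R :=
  inner (b x) (b x) - inner (a x) (a x)
  - 2 * inner (w x) (b x) + 2 * inner (w x) (a x).

Lemma integrable_inner_heat (t : R) w v : 0 < t ->
  field_integrable w -> field_integrable v ->
  torus_integrable (fun x => inner (w x) (heat t v x)).
Proof.
move=> t0 wi vi; apply: torus_integrable_sum => j.
exact: integrable_mul_heat.
Qed.

(** The same expression as a linear combination, the form in which additivity of
    the integral applies. *)
Lemma energy_gapE a b w : energy_gap a b w = fun x =>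
  inner (b x) (b x) + -1 * inner (a x) (a x) + -2 * inner (w x) (b x)
  + 2 * inner (w x) (a x).
Proof. by apply/funext => x; rewrite /energy_gap; ring. Qed.

Lemma integrable_energy_gap (t : R) v v' w : 0 < t ->
  field_integrable w -> field_integrable v -> field_integrable v' ->
  torus_integrable (energy_gap (heat t v) (heat t v') w).
Proof.
move=> t0 wi vi vi'; have ai := integrable_heat t0 vi; have bi := integrable_heat t0 vi'.
have bb := integrable_inner_heat t0 bi vi'; have aa := integrable_inner_heat t0 ai vi.
have wb := integrable_inner_heat t0 wi vi'; have wa := integrable_inner_heat t0 wi vi.
have h := torus_integrableD (torus_integrableD (torus_integrableD bb
  (torus_integrableZ (-1) aa)) (torus_integrableZ (-2) wb)) (torus_integrableZ 2 wa).
by rewrite energy_gapE.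
Qed.

Lemma torus_meanD f g : torus_integrable f -> torus_integrable g ->
  torus_mean (fun x => f x + g x) = torus_mean f + torus_mean g.
Proof. by move=> fi gi; rewrite /torus_mean RintegralD // mulrDr. Qed.

Lemma torus_meanZ (c : R) f : torus_integrable f ->
  torus_mean (fun x => c * f x) = c * torus_mean f.
Proof. by move=> fi; rewrite /torus_mean RintegralZl // mulrCA. Qed.

Definition box_dot a b N : R := \sum_(k <- box N d) \sum_(j < m)
  coef_dot (fun x => a x j ord0) (fun x => b x j ord0) k.

Definition box_energy_gap a b w N : R := \sum_(k <- box N d) \sum_(j < m)
  (coef_dot (fun x => b x j ord0) (fun x => b x j ord0) k
   - coef_dot (fun x => a x j ord0) (fun x => a x j ord0) k
   - 2 * coef_dot (fun x => w x j ord0) (fun x => b x j ord0) k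
   + 2 * coef_dot (fun x => w x j ord0) (fun x => a x j ord0) k).

Lemma box_energy_gapE a b w : box_energy_gap a b w = fun N =>
  box_dot b b N - box_dot a a N - 2 * box_dot w b N + 2 * box_dot w a N.
Proof.
apply/funext => N; rewrite /box_dot !mulr_sumr -!sumrB -!big_split /=.
apply: eq_bigr => k _; rewrite !mulr_sumr -!sumrB -big_split /=.
by apply: eq_bigr.
Qed.

Lemma cvg_energy_gap (t : R) v v' w : 0 < t ->
  field_integrable w -> field_integrable v -> field_integrable v' ->
  let a := heat t v in let b := heat t v' in
  box_energy_gap a b w @ \oo --> torus_mean (energy_gap a b w).
Proof.
move=> t0 wi vi vi' /=; have ai := integrable_heat t0 vi; have bi := integrable_heat t0 vi'.
have bb := integrable_inner_heat t0 bi vi'; have aa := integrable_inner_heat t0 ai vi.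
have wb := integrable_inner_heat t0 wi vi'; have wa := integrable_inner_heat t0 wi vi.
have -> : torus_mean (energy_gap (heat t v) (heat t v') w) =
    torus_mean (fun x => inner (heat t v' x) (heat t v' x))
    - torus_mean (fun x => inner (heat t v x) (heat t v x))
    - 2 * torus_mean (fun x => inner (w x) (heat t v' x))
    + 2 * torus_mean (fun x => inner (w x) (heat t v x)).
  rewrite -mulN1r -mulNr -(torus_meanZ (-1)) // -(torus_meanZ (-2)) // -(torus_meanZ 2) //.
  have h1 := torus_integrableD bb (torus_integrableZ (-1) aa).
  have h2 := torus_integrableD h1 (torus_integrableZ (-2) wb).
  have wb' := torus_integrableZ (-2) wb; have wa' := torus_integrableZ 2 wa.
  have aa' := torus_integrableZ (-1) aa.
  rewrite -torus_meanD // -torus_meanD // -torus_meanD //; congr (_ * _).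
  by rewrite energy_gapE.
rewrite box_energy_gapE; apply: cvgD; first apply: cvgB; first apply: cvgB.
- exact: parseval_heat t0 bi vi'.
- exact: parseval_heat t0 ai vi.
- by apply: cvgMr; exact: parseval_heat t0 wi vi'.
- by apply: cvgMr; exact: parseval_heat t0 wi vi.
Qed.

(** After two half steps, w is exp(- tau Laplacian) applied to the result. *)
Lemma fcos_heat2 (tau : R) w j k : 0 < tau -> field_integrable w ->
  fcos (fun x => w x j ord0) k = expR (tau * freq2 R k) *
    fcos (fun x => heat (tau / 2) (heat (tau / 2) w) x j ord0) k.
Proof.
move=> tau0 wi; have t0 : 0 < tau / 2 by rewrite divr_gt0.
have zi := integrable_heat t0 wi.
rewrite (heat_coord _ j zi) (fcos_heat1 t0) // (heat_coord _ j wi) (fcos_heat1 t0) //.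
rewrite !mulrA -!expRD -!mulrDl (_ : tau + - (tau / 2) + - (tau / 2) = 0).
  by rewrite mul0r expR0 mul1r.
by field.
Qed.

Lemma fsin_heat2 (tau : R) w j k : 0 < tau -> field_integrable w ->
  fsin (fun x => w x j ord0) k = expR (tau * freq2 R k) *
    fsin (fun x => heat (tau / 2) (heat (tau / 2) w) x j ord0) k.
Proof.
move=> tau0 wi; have t0 : 0 < tau / 2 by rewrite divr_gt0.
have zi := integrable_heat t0 wi.
rewrite (heat_coord _ j zi) (fsin_heat1 t0) // (heat_coord _ j wi) (fsin_heat1 t0) //.
rewrite !mulrA -!expRD -!mulrDl (_ : tau + - (tau / 2) + - (tau / 2) = 0).
  by rewrite mul0r expR0 mul1r.
by field.
Qed.

Lemma freq2_ge0 k : 0 <= freq2 R k.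
Proof. by apply: sumr_ge0 => i _; exact: sqr_ge0. Qed.

(** The energies as a quadratic form in [0, +oo] plus a finite integral: only a
    finite value of the first form leaves something to prove. *)
Lemma form_plus_integral_le (c V Ia Ib L : R) (EA EB : \bar R) : 0 < c -> 0 < V ->
  (0 <= EA)%E -> (forall A : R, EA = A%:E -> (EB <= (A - L)%:E)%E) ->
  Ib <= Ia + c * (V * L) ->
  (c%:E * (V%:E * EB) + Ib%:E <= c%:E * (V%:E * EA) + Ia%:E)%E.
Proof.
move=> c0 V0; case: EA => [A _ /(_ _ erefl) hB hI|_ _ _|]; last by rewrite leNgt ltNyr.
  apply: (@le_trans _ _ (c%:E * (V%:E * (A - L)%:E) + Ib%:E)%E).
    by rewrite leeD2r // lee_pmul2l ?lte_fin // lee_pmul2l ?lte_fin.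
  rewrite -!EFinM -!EFinD lee_fin (le_trans (lerD (lexx _) hI)) //.
  by rewrite le_eqVlt; apply/orP; left; apply/eqP; ring.
by rewrite gt0_muley ?lte_fin // gt0_muley ?lte_fin // leey.
Qed.

(** With e = exp(tau |k|^2), and b and a the Fourier coefficients at k (those of w
    being e b), the terms of the two quadratic forms and of the gap satisfy
    (e - 1)|b|^2 + |b|^2 - |a|^2 - 2 e <b, b> + 2 e <b, a> =
    (e - 1)|a|^2 - e |b - a|^2.
    Summing over a box and letting it grow compares the energies. If the form at a
    is infinite, the inequality is trivial. *)
Lemma modified_energy_le (tau : R) a b w : 0 < tau ->
  field_integrable a -> field_integrable b ->
  torus_integrable (fun x => potential tau (a x)) ->
  torus_integrable (fun x => potential tau (b x)) ->
  torus_integrable (energy_gap a b w) ->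
  (forall x, potential tau (b x) <=
     potential tau (a x) + (2 * tau)^-1 * energy_gap a b w x) ->
  (forall j k, fcos (fun x => w x j ord0) k =
     expR (tau * freq2 R k) * fcos (fun x => b x j ord0) k) ->
  (forall j k, fsin (fun x => w x j ord0) k =
     expR (tau * freq2 R k) * fsin (fun x => b x j ord0) k) ->
  box_energy_gap a b w @ \oo --> torus_mean (energy_gap a b w) ->
  (modified_energy tau b <= modified_energy tau a)%E.
Proof.
move=> tau0 ai bi Pa Pb gi ab cosb sinb; set L := torus_mean _ => hL.
have IaE := EFin_torus_Rintegral Pa; have IbE := EFin_torus_Rintegral Pb.
set Ia := \int[mu]_x potential tau (a x) in IaE.
set Ib := \int[mu]_x potential tau (b x) in IbE.
have V0 := @torus_volume_gt0 R d.
have tau20 : 0 < (2 * tau)^-1 by rewrite invr_gt0 mulr_gt0.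
have IbIa : Ib <= Ia + (2 * tau)^-1 * ((2 * pi) ^+ d * L).
  rewrite /L /torus_mean mulVKf ?gt_eqF // -RintegralZl //.
  have gi' := torus_integrableZ (2 * tau)^-1 gi.
  rewrite -RintegralD //; apply: le_Rintegral => //.
  exact: torus_integrableD.
have fn0 u k : 0 <= (expR (tau * freq2 R k) - 1) * fourier_norm2 u k.
  rewrite mulr_ge0 //.
    by rewrite subr_ge0 -expR0 ler_expR mulr_ge0 ?freq2_ge0 // ltW.
  by apply: sumr_ge0 => j _; rewrite addr_ge0 ?sqr_ge0.
pose Fa k := (expR (tau * freq2 R k) - 1) * fourier_norm2 a k.
pose Fb k := (expR (tau * freq2 R k) - 1) * fourier_norm2 b k.
have hstep (A : R) : (forall N, \sum_(k <- box N d) Fa k <= A) ->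
    forall s : seq (d.-tuple int), uniq s -> \sum_(k <- s) Fb k <= A - L.
  move=> hA s us; have [M sM] := finite_sub_box s.
  rewrite lerBrDr.
  apply: (cvgr_to_le (cvgD (cvg_cst (\sum_(k <- s) Fb k)) hL)).
  near=> N; apply: le_trans (hA N).
  have MN : (M <= N)%N by near: N; exact: nbhs_infty_ge.
  apply: (@le_trans _ _ (\sum_(k <- box N d) Fb k + box_energy_gap a b w N)).
    rewrite lerD2r; apply: ler_sum_uniq_sub => //; [exact: box_uniq| |exact: fn0].
    by move=> k /sM; exact: box_mono.
  rewrite -big_split /=; apply: ler_sum => k _.
  rewrite /Fa /Fb !fourier_norm2E //; set e := expR (tau * freq2 R k).
  rewrite !mulr_sumr -big_split /=; apply: ler_sum => j _.
  rewrite /coef_dot !cosb !sinb -/e.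
  set c := fcos (fun x => b x j ord0) k.
  set s' := fsin (fun x => b x j ord0) k.
  set c' := fcos (fun x => a x j ord0) k; set s'' := fsin (fun x => a x j ord0) k.
  (* The dissipated amount is e |b - a|^2. *)
  rewrite -subr_ge0 [X in 0 <= X](_ : _ = e * ((c - c') ^+ 2 + (s' - s'') ^+ 2)); last by ring.
  by rewrite mulr_ge0 ?expR_ge0 // addr_ge0 ?sqr_ge0.
pose EA := (\esum_(k in [set: d.-tuple int]) (Fa k)%:E)%E.
pose EB := (\esum_(k in [set: d.-tuple int]) (Fb k)%:E)%E.
have EAE : inv_heat_form tau a = (((2 * pi) ^+ d)%:E * EA)%E by [].
have EBE : inv_heat_form tau b = (((2 * pi) ^+ d)%:E * EB)%E by [].
have Age : (0 <= EA)%E by apply: esum_ge0 => k _; rewrite lee_fin fn0.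
have hAs N : ((\sum_(k <- box N d) Fa k)%:E <= EA)%E.
  apply: ereal_sup_ubound; exists [set` box N d].
    by split => //; exact: finite_seq.
  by rewrite -fsbig_seq ?box_uniq // sumEFin.
have hB (A : R) : (forall N, \sum_(k <- box N d) Fa k <= A) -> (EB <= (A - L)%:E)%E.
  move=> hA; apply: ge_ereal_sup => _ [X [finX _] <-].
  rewrite fsbig_finite //= sumEFin lee_fin; apply: hstep => //; exact: fset_uniq.
rewrite /modified_energy IaE IbE EAE EBE.
apply: (form_plus_integral_le tau20 V0 Age _ IbIa) => A EAA; apply: hB => N.
by rewrite -lee_fin -EAA.
Unshelve. all: by end_near. Qed.

Lemma strang_energy_le (tau : R) v : 0 < tau -> field_integrable v ->
  (modified_energy tau (heat (tau / 2) (strang_step tau v)) <=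
   modified_energy tau (heat (tau / 2) v))%E.
Proof.
move=> tau0 vi; have t0 : 0 < tau / 2 by rewrite divr_gt0.
have ai := integrable_heat t0 vi.
have wi := integrable_reaction tau0 ai.
have zi := integrable_heat t0 wi.
have bi := integrable_heat t0 zi.
apply: (modified_energy_le tau0 ai bi (w := fun x => reaction tau (heat (tau / 2) v x))).
- exact: integrable_potential tau0 t0 vi.
- exact: integrable_potential tau0 t0 zi.
- exact: integrable_energy_gap t0 wi vi zi.
- by move=> x; exact: potential_step.
- by move=> j k; exact: fcos_heat2.
- by move=> j k; exact: fsin_heat2.
- exact: cvg_energy_gap t0 wi vi zi.
Qed.

Lemma strang_integrable (tau : R) u n : 0 < tau -> L2 u ->
  field_integrable (strang tau u n).
Proof.
move=> tau0 uL; have t0 : 0 < tau / 2 by rewrite divr_gt0.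
elim: n => [|n IH]; first exact: L2_integrable.
by apply: integrable_heat => //; apply: integrable_reaction => //; exact: integrable_heat.
Qed.

(** Each of the three substeps preserves a pointwise bound M >= 1. *)
Lemma strang_step_enorm_le (tau M : R) v x : 0 < tau -> 1 <= M ->
  field_integrable v -> (\forall y \ae mu, enorm (v y) <= M) ->
  enorm (strang_step tau v x) <= M.
Proof.
move=> tau0 M1 vi vM; have t0 : 0 < tau / 2 by rewrite divr_gt0.
have M0 : 0 <= M by exact: le_trans M1.
have ai := integrable_heat t0 vi.
apply: heat_enorm_le => //; first exact: integrable_reaction.
apply: aeW => y; apply: le_trans (reaction_enorm _ tau0) _.
by rewrite ge_max M1 heat_enorm_le.
Qed.

Lemma strang_step_Linfty_le (tau : R) v : 0 < tau -> field_integrable v ->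
  (Linfty_norm (strang_step tau v) <= maxe 1 (Linfty_norm v))%E.
Proof.
move=> tau0 vi; have := @ess_sup_ge _ _ _ mu (fun x => (enorm (v x))%:E).
rewrite -/(Linfty_norm v); case E : (Linfty_norm v) => [r| |] vr.
- apply/ess_supP; apply: aeW => x; rewrite -EFin_max lee_fin.
  apply: strang_step_enorm_le => //; first by rewrite le_max lexx.
  by apply: filterS vr => y; rewrite lee_fin le_max => ->; rewrite orbT.
- by rewrite maxey leey.
- apply/ess_supP; apply: aeW => x; rewrite maxeNy lee_fin.
  apply: strang_step_enorm_le => //.
  by apply: filterS vr => y; rewrite leNgt ltNyr.
Qed.

End energy.

Theorem theorem1p1 (R : realType) (d m : nat) (tau : R)
    (u0 : Rspace R d -> 'cV[R]_m) (hd1 : (1 <= d)%N) (hd3 : (d <= 3)%N)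
    (hm : (1 <= m)%N) (htau : 0 < tau) (hu0 : L2 u0) :
  let u := strang tau u0 in
  let ut := fun n => heat (tau / 2) (u n) in
  [/\ (forall n, (Linfty_norm (u n.+1) <= maxe 1 (Linfty_norm (u n)))%E),
      (ereal_sup [set Linfty_norm (u n) | n in [set n : nat | (1 <= n)%N]]
         <= maxe 1 (Linfty_norm u0))%E,
      ((Linfty_norm u0 <= 1)%E ->
       (ereal_sup [set Linfty_norm (u n) | n in [set n : nat | (1 <= n)%N]]
         <= 1)%E)
    & (forall n, (modified_energy tau (ut n.+1) <= modified_energy tau (ut n))%E)].
Proof.
move=> u ut.
have step n : (Linfty_norm (u n.+1) <= maxe 1 (Linfty_norm (u n)))%E.
  by apply: strang_step_Linfty_le => //; exact: strang_integrable.
have bound n : (Linfty_norm (u n) <= maxe 1 (Linfty_norm u0))%E.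
  elim: n => [|n IH]; first by rewrite le_max lexx orbT.
  by rewrite (le_trans (step n)) // ge_max IH le_max lexx.
have sup : (ereal_sup [set Linfty_norm (u n) | n in [set n : nat | (1 <= n)%N]]
    <= maxe 1 (Linfty_norm u0))%E.
  by apply: ge_ereal_sup => _ [n _ <-]; exact: bound.
split; [exact: step|exact: sup| |].
  by move=> h; rewrite (le_trans sup) // ge_max lexx.
by move=> n; apply: (strang_energy_le htau); exact: strang_integrable.
Qed.
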